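(* Let $c,d,e$ be real, put $g_2=\frac{c^2}{12}-d$ and $g_3=-\frac{cd}{12}+\frac e4+\frac{c^3}{216}$, assume $g_2^3-27g_3^2\neq0$, and let $\wp,\zeta,\sigma$ be the Weierstrass functions with invariants $g_2,g_3$. Let $x_0\in\mathbb{C}\setminus\{0\}$ and let $\tilde q(x)=-2\wp(x+x_0)-\frac16c$, a solution of $$(\tilde q')^2+2\tilde q^3+c\tilde q^2+2d\tilde q+e=0.$$ For $E\in\mathbb{R}$ choose $\rho$ with $\wp(\rho)=E$ and define $\hat\gamma_E=(\hat\gamma_E^1,\hat\gamma_E^2)$ by $$\hat\gamma_E^1(x)=\frac{\sigma(x+x_0-\rho)}{\sigma(x+x_0)}e^{\zeta(\rho)(x+x_0)},\qquad \hat\gamma_E^2(x)=\frac{\sigma(x+x_0+\rho)}{\sigma(x+x_0)}e^{\zeta(-\rho)(x+x_0)}.$$ If $E$ is not a branch point of $\wp$ (i.e. $4E^3-g_2E-g_3\ne0$), then $\hat\gamma_E$ induces a curve $\gamma_E=[\hat\gamma_E^1,\hat\gamma_E^2]$ in $\mathbb{CP}^1$, $x\in\mathbb{R}$, whose Schwarzian derivative is $q_E=\tilde q+\frac16c-E$.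
   Context: Schwarzian derivative: for a regular curve $\gamma$ in $\mathbb{CP}^1$ choose a lift to $\mathbb{C}^2\setminus\{0\}$ and rescale it by a complex-valued function to obtain a lift $\hat\gamma$ with $\det_{\mathbb{C}}(\hat\gamma,\hat\gamma')=1$; then $\hat\gamma''+q\hat\gamma=0$ for a unique function $q$, called the Schwarzian derivative of the curve (equivalently, $q$ is the function such that some lift with constant nonzero $\det(\hat\gamma,\hat\gamma')$ solves $\hat\gamma''+q\hat\gamma=0$). If $x+x_0$ meets the period lattice, the equality of Schwarzian derivatives is understood away from those points. Weierstrass functions: $\wp'^2=4\wp^3-g_2\wp-g_3$, $\zeta'=-\wp$ with $\zeta(z)-1/z\to0$ as $z\to0$, $\sigma'/\sigma=\zeta$ with $\sigma(z)/z\to1$ as $z\to0$. *)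

(* Defs.v *)
From Stdlib Require Import Reals.
From Coquelicot Require Import Coquelicot.

Local Open Scope C_scope.

Definition Cexp (z : C) : C :=
  (exp (Re z) * cos (Im z), exp (Re z) * sin (Im z))%R.

(* Meant for open [U].  Functions are total, so nothing is said outside [U].
   For [K = R] this is C^infinity smoothness; for [K = C] and [V = C] it is
   holomorphy (a complex differentiable function is so to all orders). *)
Definition smooth_on {K : AbsRing} {V : NormedModule K}
    (U : K -> Prop) (f : K -> V) : Prop :=
  exists D : nat -> K -> V,
    (forall x, U x -> D 0%nat x = f x) /\
    (forall n x, U x -> is_derive (D n) x (D (S n) x)).

Definition holomorphic_on (U : C -> Prop) (f : C -> C) : Prop :=
  smooth_on (K := C_AbsRing) (V := C_NormedModule) U f.

(* The condition on [Im] says that the periods are linearly independent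
   over R. *)
Definition is_lattice (L : C -> Prop) : Prop :=
  exists w1 w2 : C,
    Im (w1 * Cconj w2) <> 0%R /\
    forall z, L z <-> exists m n : Z, z = IZR m * w1 + IZR n * w2.

(* [L] is the period lattice.  The values of [wp] and [zeta] on [L], where
   these functions have their poles, are unspecified.  The normalisations at 0
   make [L] the exact set of poles of [wp] and determine [sigma], and [wp] and
   [zeta] off [L], from [g2] and [g3]. *)
Record weierstrass (g2 g3 : C) (L : C -> Prop) (wp zeta sigma : C -> C)
    : Prop := {
  w_lattice : is_lattice L;
  wp_holomorphic : holomorphic_on (fun z => ~ L z) wp;
  wp_periodic : forall z w, ~ L z -> L w -> wp (z + w) = wp z;
  wp_pole : filterlim (fun z : C => z * z * wp z)
              (locally' (RtoC 0)) (locally (RtoC 1));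
  wp_ode : forall z, ~ L z ->
    exists p : C, is_derive wp z p /\
      p * p = 4 * (wp z * wp z * wp z) - g2 * wp z - g3;
  zeta_derive : forall z, ~ L z -> is_derive zeta z (- wp z);
  zeta_pole : filterlim (fun z : C => zeta z - / z)
                (locally' (RtoC 0)) (locally (RtoC 0));
  sigma_entire : holomorphic_on (fun _ => True) sigma;
  sigma_log_derive : forall z, ~ L z ->
    sigma z <> 0 /\
    exists s : C, is_derive sigma z s /\ s / sigma z = zeta z;
  sigma_zero : filterlim (fun z : C => sigma z / z)
                 (locally' (RtoC 0)) (locally (RtoC 1))
}.

Definition det2 (u v : C * C) : C := fst u * snd v - snd u * fst v.

(* A point of CP^1 is a complex line through the origin of C^2. *)
Record CP1 : Type := {
  line : C * C -> Prop;
  line_spec : exists v : C * C, v <> (RtoC 0, RtoC 0) /\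
    forall u, line u <-> exists k : C, u = (k * fst v, k * snd v)
}.

(* [p = [v_1, v_2]] *)
Definition homog_coord (p : CP1) (v : C * C) : Prop :=
  v <> (RtoC 0, RtoC 0) /\ line p v.

Definition smooth_curve (gamma : R -> CP1) : Prop :=
  forall x0 : R, exists (eps : posreal) (h : R -> C * C),
    smooth_on (K := R_AbsRing)
      (V := prod_NormedModule R_AbsRing C_R_NormedModule C_R_NormedModule)
      (fun x => Rabs (x - x0) < eps)%R h /\
    forall x, (Rabs (x - x0) < eps)%R -> homog_coord (gamma x) (h x).

(* [q] is the Schwarzian derivative of [gamma] on the open set [D].  The
   normalisation of the determinant makes [gamma] regular on [D], and it fixes
   the lift [h] up to a locally constant sign, so that [q] is unique on [D]. *)
Definition schwarzian_on (D : R -> Prop) (gamma : R -> CP1) (q : R -> C)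
    : Prop :=
  exists h h' h'' : R -> C * C, forall x, D x ->
    homog_coord (gamma x) (h x) /\
    is_derive h x (h' x) /\
    is_derive h' x (h'' x) /\
    det2 (h x) (h' x) = 1 /\
    fst (h'' x) + q x * fst (h x) = 0 /\
    snd (h'' x) + q x * snd (h x) = 0.

Definition q_tilde (wp : C -> C) (x0 : C) (c : R) (x : R) : C :=
  - (2) * wp (x + x0) - / 6 * c.

Definition gamma_hat (zeta sigma : C -> C) (x0 rho : C) (x : R) : C * C :=
  (sigma (x + x0 - rho) / sigma (x + x0) * Cexp (zeta rho * (x + x0)),
   sigma (x + x0 + rho) / sigma (x + x0) * Cexp (zeta (- rho) * (x + x0))).

(* Main.v *)
Require Import Defs.
From Stdlib Require Import Reals Lra Lia Classical.
From Coquelicot Require Import Coquelicot.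
Local Open Scope C_scope.

(** Write [u = x + x0]. Since [sigma' / sigma = zeta], the component
    [f = sigma (u - rho) / sigma u * exp (zeta rho * u)] has logarithmic derivative
    [G u = zeta (u - rho) - zeta u + zeta rho], and the Lamé equation [f'' = (2 wp u + E) f] amounts to
    the addition theorem [G^2 = wp u + wp (u - rho) + wp rho]. As [wp] is even, the second component
    (with [- rho] for [rho]) solves the same equation. The Wronskian of the two is constant, and at
    [u = rho] it is seen to be nonzero, because [2 rho] is not a period when [wp' rho <> 0]; dividing by a
    square root of it normalises the lift. Multiplying by [sigma u] gives a lift without poles.

    No Cauchy theory is used: evenness and the addition theorem come from uniqueness for differential
    equations. Differentiating the first-order equation and using the discriminant gives
    [wp'' = 6 wp^2 - g2/2]. The reciprocal of a solution with a double pole solves a regular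
    second-order equation, so such a solution is determined near its pole. Applied to
    [((wp' u + wp' rho) / (2 (wp u - wp rho)))^2 - wp u - wp rho] at [u = rho], this gives the
    addition theorem near [rho], and a linear system satisfied by
    [G^2 - wp u - wp (u - rho) - wp rho] and its derivatives propagates it along paths avoiding the
    poles. *)

(** The first-order equation cannot serve for uniqueness: the sign of [wp'] is free and the roots of
    the cubic are constant solutions, so initial values at a zero of [wp'] determine nothing. The
    second-order equation is locally Lipschitz, and for the reciprocal it stays regular at the pole,
    where the initial data are always value 0 and slope 0. Without an identity theorem the zeros of
    [wp'] are not known to be isolated, so a factor [wp'] cannot be cancelled; a pointwise case
    distinction replaces the cancellation. The same obstacle decides what is propagated: the
    quotient [(wp' u + wp' rho) / (2 (wp u - wp rho))] is singular wherever [wp u = wp rho], a set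
    about which nothing is known away from [rho], whereas the identity for [G^2] involves only the
    poles in [L] and [rho + L]. The quotient is therefore used near [rho] alone, where it equals [G]
    because both have the same derivative and the same expansion [1/(u - rho) + o(1)]. *)

Lemma Cmult_integral (a b : C) : a * b = 0 -> a = 0 \/ b = 0.
Proof.
  intros H. apply NNPP. intros Hn. apply (Cmult_neq_0 a b); tauto.
Qed.

Lemma Cinv_neq_0 (a : C) : a <> 0 -> / a <> 0.
Proof.
  intros H E. apply C1_nz. rewrite <- (Cinv_r a H), E. ring.
Qed.

Lemma Cminus_neq_0 (a b : C) : a <> b -> a - b <> 0.
Proof. intros H E. apply H. replace a with (b + (a - b)) by ring. rewrite E. ring. Qed.

(** * Differentiation of complex functions *)

Definition is_Cderive (f : C -> C) (z l : C) : Prop :=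
  is_derive (K := C_AbsRing) (V := C_NormedModule) f z l.

Definition is_RCderive (f : R -> C) (x : R) (l : C) : Prop :=
  is_derive (K := R_AbsRing) (V := C_R_NormedModule) f x l.

Lemma is_derive_eps {K : AbsRing} {V : NormedModule K} (f : K -> V) (x : K) (l : V) :
  is_derive f x l <->
  forall eps : R, (0 < eps)%R -> exists del : R, (0 < del)%R /\
    forall y : K, (abs (minus y x) < del)%R ->
      (norm (minus (minus (f y) (f x)) (scal (minus y x) l)) <= eps * abs (minus y x))%R.
Proof.
  split.
  - intros [_ H] eps Heps.
    destruct (H x (fun P HP => HP) (mkposreal eps Heps)) as [del Hdel].
    exists del; split; [apply cond_pos|].
    intros y Hy. apply (Hdel y). exact Hy.
  - intros H; split; [apply is_linear_scal_l|].
    intros y Hy. apply (is_filter_lim_locally_unique (V := AbsRing_NormedModule K)) in Hy. subst y. intros eps.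
    destruct (H eps (cond_pos eps)) as [del [Hdel H']].
    exists (mkposreal del Hdel). intros y Hy. apply H'. exact Hy.
Qed.

Lemma is_Cderive_eps (f : C -> C) (z l : C) :
  is_Cderive f z l <->
  forall eps : R, (0 < eps)%R -> exists del : R, (0 < del)%R /\
    forall w : C, (Cmod (w - z) < del)%R ->
      (Cmod (f w - f z - (w - z) * l) <= eps * Cmod (w - z))%R.
Proof. exact (is_derive_eps (K := C_AbsRing) (V := C_NormedModule) f z l). Qed.

Lemma is_RCderive_eps (f : R -> C) (x : R) (l : C) :
  is_RCderive f x l <->
  forall eps : R, (0 < eps)%R -> exists del : R, (0 < del)%R /\
    forall y : R, (Rabs (y - x) < del)%R ->
      (Cmod (f y - f x - RtoC (y - x) * l) <= eps * Rabs (y - x))%R.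
Proof.
  unfold is_RCderive. rewrite (is_derive_eps (K := R_AbsRing) (V := C_R_NormedModule) f x l).
  split; intros H eps Heps; destruct (H eps Heps) as [del [Hdel H']];
    exists del; (split; [exact Hdel|]); intros y Hy; specialize (H' y Hy);
    rewrite <- scal_R_Cmult in * |- *; rewrite Cmod_norm in *; exact H'.
Qed.

(** [C] is a normed module over itself in two formally different ways, and the product and chain
    rules speak of the second. The epsilon form of the derivative is the same for both. *)
Lemma is_Cderive_ring (f : C -> C) (z l : C) :
  is_Cderive f z l <->
  @is_derive C_AbsRing (AbsRing_NormedModule C_AbsRing) f z l.
Proof.
  rewrite is_Cderive_eps.
  symmetry. apply (is_derive_eps (K := C_AbsRing) (V := AbsRing_NormedModule C_AbsRing) f z l).
Qed.

Lemma is_Cderive_eq (f : C -> C) (z l l' : C) :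
  is_Cderive f z l -> l = l' -> is_Cderive f z l'.
Proof. intros H <-; exact H. Qed.

Lemma is_Cderive_plus (f g : C -> C) (z l m : C) :
  is_Cderive f z l -> is_Cderive g z m -> is_Cderive (fun w => f w + g w) z (l + m).
Proof. exact (is_derive_plus (K := C_AbsRing) (V := C_NormedModule) f g z l m). Qed.

Lemma is_Cderive_minus (f g : C -> C) (z l m : C) :
  is_Cderive f z l -> is_Cderive g z m -> is_Cderive (fun w => f w - g w) z (l - m).
Proof. exact (is_derive_minus (K := C_AbsRing) (V := C_NormedModule) f g z l m). Qed.

Lemma is_Cderive_opp (f : C -> C) (z l : C) :
  is_Cderive f z l -> is_Cderive (fun w => - f w) z (- l).
Proof. exact (is_derive_opp (K := C_AbsRing) (V := C_NormedModule) f z l). Qed.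

Lemma is_Cderive_const (a z : C) : is_Cderive (fun _ => a) z 0.
Proof. exact (is_derive_const (K := C_AbsRing) (V := C_NormedModule) a z). Qed.

Lemma is_Cderive_id (z : C) : is_Cderive (fun w => w) z 1.
Proof. apply is_Cderive_ring. exact (is_derive_id (K := C_AbsRing) z). Qed.

Lemma is_Cderive_comp (f g : C -> C) (z l m : C) :
  is_Cderive f (g z) l -> is_Cderive g z m -> is_Cderive (fun w => f (g w)) z (l * m).
Proof.
  intros Hf Hg. apply is_Cderive_ring in Hg.
  apply is_Cderive_eq with (m * l); [|apply Cmult_comm].
  exact (is_derive_comp (K := C_AbsRing) (V := C_NormedModule) f g z l m Hf Hg).
Qed.

Lemma is_Cderive_mult (f g : C -> C) (z l m : C) :
  is_Cderive f z l -> is_Cderive g z m ->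
  is_Cderive (fun w => f w * g w) z (l * g z + f z * m).
Proof.
  intros Hf Hg. apply is_Cderive_ring. apply is_Cderive_ring in Hf, Hg.
  unfold is_derive.
  eapply filterdiff_ext_lin.
  - apply (filterdiff_mult_fct (K := C_AbsRing) (U := AbsRing_NormedModule C_AbsRing) f g z); [apply Cmult_comm | exact Hf | exact Hg].
  - intros y. unfold scal, plus; simpl. unfold mult; simpl. ring.
Qed.

Lemma is_Cderive_inv_id (z : C) : z <> 0 -> is_Cderive Cinv z (- (/ (z * z))).
Proof.
  intros Hz. apply is_Cderive_eps. intros eps Heps.
  assert (Hm : (0 < Cmod z)%R) by (apply Cmod_gt_0; exact Hz).
  (* The remainder is [(w - z)^2 / (z^2 w)]. The first bound keeps [Cmod w] above [Cmod z / 2]; the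
     second then makes [(w - z) / (z^2 w)] smaller than [eps]. *)
  exists (Rmin (Cmod z / 2) (eps * (Cmod z ^ 3) / 2)).
  assert (H3 : (0 < Cmod z ^ 3)%R) by (apply pow_lt; exact Hm).
  split. { apply Rmin_pos; [lra|]. apply Rdiv_lt_0_compat; [|lra]. apply Rmult_lt_0_compat; lra. }
  intros w Hw.
  assert (Hw1 : (Cmod (w - z) < Cmod z / 2)%R) by (eapply Rlt_le_trans; [exact Hw | apply Rmin_l]).
  assert (Hw2 : (Cmod (w - z) < eps * Cmod z ^ 3 / 2)%R) by (eapply Rlt_le_trans; [exact Hw | apply Rmin_r]).
  assert (Hwm : (Cmod z / 2 < Cmod w)%R).
  { pose proof (Cmod_triangle w (z - w)) as T. replace (w + (z - w)) with z in T by ring.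
    replace (z - w) with (- (w - z)) in T by ring. rewrite Cmod_opp in T. lra. }
  assert (Hw0 : w <> 0). { intros ->. rewrite Cmod_0 in Hwm. lra. }
  replace (/ w - / z - (w - z) * - / (z * z)) with ((w - z) * ((w - z) / (z * z * w)))
    by (field; auto).
  rewrite Cmod_mult, (Rmult_comm eps). apply Rmult_le_compat_l; [apply Cmod_ge_0|].
  rewrite Cmod_div, !Cmod_mult by (repeat apply Cmult_neq_0; assumption).
  apply Rle_div_l. { repeat apply Rmult_lt_0_compat; lra. }
  apply Rle_trans with (eps * Cmod z ^ 3 / 2)%R; [lra|].
  replace (eps * Cmod z ^ 3 / 2)%R with (eps * (Cmod z * Cmod z * (Cmod z / 2)))%R by field.
  apply Rmult_le_compat_l; [lra|]. apply Rmult_le_compat_l; [nra|]. lra.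
Qed.

Lemma is_Cderive_inv (f : C -> C) (z l : C) :
  is_Cderive f z l -> f z <> 0 -> is_Cderive (fun w => / f w) z (- l / (f z * f z)).
Proof.
  intros Hf Hz.
  eapply is_Cderive_eq; [apply (is_Cderive_comp Cinv f); [apply is_Cderive_inv_id; exact Hz | exact Hf]|].
  field. exact Hz.
Qed.

Lemma is_Cderive_unique (f : C -> C) (z l m : C) :
  is_Cderive f z l -> is_Cderive f z m -> l = m.
Proof.
  intros Hl Hm. rewrite <- (is_C_derive_unique _ _ _ Hl). apply is_C_derive_unique. exact Hm.
Qed.

Lemma is_Cderive_ext_near (f g : C -> C) (z l : C) (del : R) :
  (0 < del)%R -> (forall w, (Cmod (w - z) < del)%R -> f w = g w) ->
  is_Cderive f z l -> is_Cderive g z l.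
Proof.
  intros Hdel H. apply (is_derive_ext_loc (K := C_AbsRing) (V := C_NormedModule)).
  exists (mkposreal del Hdel). exact H.
Qed.

Lemma is_RCderive_path (f : C -> C) (a b l : C) (t : R) :
  is_Cderive f (a + t * b) l -> is_RCderive (fun s : R => f (a + s * b)) t (l * b).
Proof.
  intros H. apply is_RCderive_eps. intros eps Heps.
  set (B := (Cmod b + 1)%R).
  assert (HB : (0 < B)%R) by (pose proof (Cmod_ge_0 b); unfold B; lra).
  apply is_Cderive_eps with (eps := (eps / B)%R) in H; [|apply Rdiv_lt_0_compat; lra].
  destruct H as [del [Hdel H]].
  exists (del / B)%R; split; [apply Rdiv_lt_0_compat; lra|].
  intros y Hy.
  assert (Hd : (Cmod (a + y * b - (a + t * b)) = Rabs (y - t) * Cmod b)%R).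
  { replace (a + y * b - (a + t * b)) with (RtoC (y - t) * b) by (rewrite RtoC_minus; ring).
    rewrite Cmod_mult, Cmod_R. reflexivity. }
  assert (Hle : (Rabs (y - t) * Cmod b <= Rabs (y - t) * B)%R).
  { apply Rmult_le_compat_l; [apply Rabs_pos | unfold B; lra]. }
  assert (Hlt : (Rabs (y - t) * B < del)%R).
  { apply Rlt_div_r in Hy; [exact Hy | exact HB]. }
  assert (H' := H (a + y * b)). rewrite Hd in H'. specialize (H' ltac:(lra)).
  replace (f (a + y * b) - f (a + t * b) - (y - t)%R * (l * b))
    with (f (a + y * b) - f (a + t * b) - (a + y * b - (a + t * b)) * l)
    by (rewrite RtoC_minus; ring).
  eapply Rle_trans; [exact H'|].
  replace (eps * Rabs (y - t))%R with (eps / B * (Rabs (y - t) * B))%R by (field; lra).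
  apply Rmult_le_compat_l; [apply Rlt_le, Rdiv_lt_0_compat; lra | exact Hle].
Qed.

(** * Limits along filters *)

(** Like [locally'], but with radii measured by [Cmod], the form in which all estimates below are
    made. *)
Definition pnbhd (a : C) (P : C -> Prop) : Prop :=
  exists del : R, (0 < del)%R /\ forall z, z <> a -> (Cmod (z - a) < del)%R -> P z.

Global Instance pnbhd_proper (a : C) : ProperFilter (pnbhd a).
Proof.
  split; [|split].
  - intros P [del [Hdel H]]. exists (a + RtoC (del / 2)).
    assert (E : a + RtoC (del / 2) - a = RtoC (del / 2)) by ring.
    apply H.
    + intros E'. rewrite E' in E. replace (a - a) with (RtoC 0) in E by ring.
      apply RtoC_inj in E. lra.
    + rewrite E, Cmod_R, Rabs_pos_eq; lra.
  - exists 1%R; split; [lra | trivial].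
  - intros P Q [d1 [H1 HP]] [d2 [H2 HQ]]. exists (Rmin d1 d2).
    split; [apply Rmin_pos; assumption|]. intros z Hz Hd. split.
    + apply HP; [exact Hz | eapply Rlt_le_trans; [exact Hd | apply Rmin_l]].
    + apply HQ; [exact Hz | eapply Rlt_le_trans; [exact Hd | apply Rmin_r]].
  - intros P Q HPQ [d [Hd HP]]. exists d; split; [exact Hd|]. intros z Hz Hz'. apply HPQ, HP; assumption.
Qed.

Definition tends (F : (C -> Prop) -> Prop) (g : C -> C) (l : C) : Prop :=
  forall eps : R, (0 < eps)%R -> F (fun z => Cmod (g z - l) < eps)%R.

Section Tends.
Context (F : (C -> Prop) -> Prop) {HF : ProperFilter F}.

Lemma tends_ext (f g : C -> C) (l : C) :
  F (fun z => f z = g z) -> tends F f l -> tends F g l.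
Proof.
  intros H Hf eps Heps. generalize (filter_and (F := F) _ _ H (Hf eps Heps)).
  apply filter_imp. intros z [-> Hz]. exact Hz.
Qed.

Lemma tends_eq (f : C -> C) (l l' : C) : tends F f l -> l = l' -> tends F f l'.
Proof. intros H <-; exact H. Qed.

Lemma tends_const (a : C) : tends F (fun _ => a) a.
Proof.
  intros eps Heps. apply filter_forall. intros _.
  replace (a - a) with (RtoC 0) by ring. rewrite Cmod_0. exact Heps.
Qed.

Lemma tends_plus (f g : C -> C) (l m : C) :
  tends F f l -> tends F g m -> tends F (fun z => f z + g z) (l + m).
Proof.
  intros Hf Hg eps Heps.
  generalize (filter_and (F := F) _ _ (Hf (eps / 2)%R ltac:(lra)) (Hg (eps / 2)%R ltac:(lra))).
  apply filter_imp. intros z [H1 H2].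
  replace (f z + g z - (l + m)) with ((f z - l) + (g z - m)) by ring.
  eapply Rle_lt_trans; [apply Cmod_triangle | lra].
Qed.

Lemma tends_bounded (f : C -> C) (l : C) :
  tends F f l -> F (fun z => Cmod (f z) < Cmod l + 1)%R.
Proof.
  intros Hf. generalize (Hf 1%R ltac:(lra)). apply filter_imp. intros z Hz.
  pose proof (Cmod_triangle (f z - l) l) as T. replace (f z - l + l) with (f z) in T by ring. lra.
Qed.

Lemma tends_zero_mult (f g : C -> C) (B : R) :
  tends F f 0 -> F (fun z => Cmod (g z) <= B)%R -> tends F (fun z => f z * g z) 0.
Proof.
  intros Hf Hg eps Heps.
  set (B' := (Rabs B + 1)%R).
  assert (HB : (0 < B')%R) by (pose proof (Rabs_pos B); unfold B'; lra).
  generalize (filter_and (F := F) _ _ (Hf (eps / B')%R ltac:(apply Rdiv_lt_0_compat; lra)) Hg).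
  apply filter_imp. intros z [H1 H2].
  replace (f z - 0) with (f z) in H1 by ring. replace (f z * g z - 0) with (f z * g z) by ring.
  rewrite Cmod_mult.
  apply Rlt_div_r in H1; [|exact HB].
  eapply Rle_lt_trans; [|exact H1]. apply Rmult_le_compat_l; [apply Cmod_ge_0|].
  pose proof (Rle_abs B). unfold B'; lra.
Qed.

Lemma tends_mult (f g : C -> C) (l m : C) :
  tends F f l -> tends F g m -> tends F (fun z => f z * g z) (l * m).
Proof.
  intros Hf Hg.
  assert (Hf0 : tends F (fun z => f z - l) 0).
  { apply (tends_eq _ (l + - l)); [|ring]. exact (tends_plus _ _ _ _ Hf (tends_const (- l))). }
  assert (Hg0 : tends F (fun z => g z - m) 0).
  { apply (tends_eq _ (m + - m)); [|ring]. exact (tends_plus _ _ _ _ Hg (tends_const (- m))). }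
  apply tends_ext with (f := fun z => ((f z - l) * g z + (g z - m) * l) + l * m).
  - apply filter_forall. intros z. ring.
  - apply (tends_eq _ ((0 + 0) + l * m)); [|ring].
    apply tends_plus; [|apply tends_const]. apply tends_plus.
    + apply (tends_zero_mult _ _ (Cmod m + 1)); [exact Hf0|].
      generalize (tends_bounded _ _ Hg). apply filter_imp. intros; lra.
    + apply (tends_zero_mult _ _ (Cmod l)); [exact Hg0|]. apply filter_forall. intros; lra.
Qed.

Lemma tends_opp (f : C -> C) (l : C) : tends F f l -> tends F (fun z => - f z) (- l).
Proof.
  intros H eps Heps. generalize (H eps Heps). apply filter_imp. intros z Hz.
  replace (- f z - - l) with (- (f z - l)) by ring. rewrite Cmod_opp. exact Hz.
Qed.

Lemma tends_minus (f g : C -> C) (l m : C) :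
  tends F f l -> tends F g m -> tends F (fun z => f z - g z) (l - m).
Proof. intros Hf Hg. exact (tends_plus _ _ _ _ Hf (tends_opp _ _ Hg)). Qed.

Lemma tends_neq (f : C -> C) (l m : C) : tends F f l -> l <> m -> F (fun z => f z <> m).
Proof.
  intros H Hl.
  assert (H0 : (0 < Cmod (m - l))%R).
  { apply Cmod_gt_0. intros E. apply Hl. replace l with (m - (m - l)) by ring. rewrite E. ring. }
  generalize (H _ H0). apply filter_imp. intros z Hz E. rewrite E in Hz. lra.
Qed.

(** Differentiability of the inversion at [l] already contains the Lipschitz bound that is needed
    near [l]. *)
Lemma tends_inv (f : C -> C) (l : C) : tends F f l -> l <> 0 -> tends F (fun z => / f z) (/ l).
Proof.
  intros H Hl eps Heps.
  destruct (proj1 (is_Cderive_eps _ _ _) (is_Cderive_inv_id l Hl) 1%R ltac:(lra)) as [del [Hdel Hd]].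
  set (B := (1 + Cmod (- / (l * l)) + 1)%R).
  assert (HB : (0 < B)%R) by (pose proof (Cmod_ge_0 (- / (l * l))); unfold B; lra).
  assert (Hm : (0 < Rmin del (eps / B))%R) by (apply Rmin_pos; [exact Hdel | apply Rdiv_lt_0_compat; lra]).
  generalize (H _ Hm). apply filter_imp. intros z Hz.
  specialize (Hd (f z) (Rlt_le_trans _ _ _ Hz (Rmin_l _ _))).
  assert (Hz2 := Rlt_le_trans _ _ _ Hz (Rmin_r _ _)). apply Rlt_div_r in Hz2; [|exact HB].
  eapply Rle_lt_trans; [|exact Hz2].
  pose proof (Cmod_triangle (/ f z - / l - (f z - l) * - / (l * l)) ((f z - l) * - / (l * l))) as T.
  replace (/ f z - / l - (f z - l) * - / (l * l) + (f z - l) * - / (l * l))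
    with (/ f z - / l) in T by ring.
  rewrite (Cmod_mult (f z - l)) in T. pose proof (Cmod_ge_0 (f z - l)). unfold B. lra.
Qed.

Lemma tends_unique (f : C -> C) (l m : C) : tends F f l -> tends F f m -> l = m.
Proof.
  intros Hl Hm. apply NNPP. intros Hne.
  assert (H0 : (0 < Cmod (l - m) / 2)%R).
  { apply Rdiv_lt_0_compat; [|lra]. apply Cmod_gt_0. intros E. apply Hne.
    replace l with (m + (l - m)) by ring. rewrite E. ring. }
  destruct (filter_ex (F := F) _ (filter_and (F := F) _ _ (Hl _ H0) (Hm _ H0))) as [z [H1 H2]].
  pose proof (Cmod_triangle (l - f z) (f z - m)) as T.
  replace (l - f z + (f z - m)) with (l - m) in T by ring.
  replace (l - f z) with (- (f z - l)) in T by ring. rewrite Cmod_opp in T. lra.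
Qed.

End Tends.

Lemma tends_derivable (f : C -> C) (z l : C) : is_Cderive f z l -> tends (pnbhd z) f (f z).
Proof.
  intros H eps Heps.
  destruct (proj1 (is_Cderive_eps _ _ _) H 1%R ltac:(lra)) as [del [Hdel Hd]].
  set (B := (1 + Cmod l + 1)%R).
  assert (HB : (0 < B)%R) by (pose proof (Cmod_ge_0 l); unfold B; lra).
  exists (Rmin del (eps / B)). split; [apply Rmin_pos; [exact Hdel | apply Rdiv_lt_0_compat; lra]|].
  intros w _ Hw.
  specialize (Hd w (Rlt_le_trans _ _ _ Hw (Rmin_l _ _))).
  assert (Hz2 := Rlt_le_trans _ _ _ Hw (Rmin_r _ _)). apply Rlt_div_r in Hz2; [|exact HB].
  eapply Rle_lt_trans; [|exact Hz2].
  pose proof (Cmod_triangle (f w - f z - (w - z) * l) ((w - z) * l)) as T.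
  replace (f w - f z - (w - z) * l + (w - z) * l) with (f w - f z) in T by ring.
  rewrite (Cmod_mult (w - z)) in T. pose proof (Cmod_ge_0 (w - z)). unfold B. lra.
Qed.

Lemma is_Cderive_slope (f : C -> C) (z l : C) :
  is_Cderive f z l <-> tends (pnbhd z) (fun w => (f w - f z) / (w - z)) l.
Proof.
  assert (E : forall w, w <> z ->
    (Cmod (f w - f z - (w - z) * l) = Cmod ((f w - f z) / (w - z) - l) * Cmod (w - z))%R).
  { intros w Hw. rewrite <- Cmod_mult. f_equal. field. intros E. apply Hw.
    replace w with (z + (w - z)) by ring. rewrite E. ring. }
  assert (P : forall w, w <> z -> (0 < Cmod (w - z))%R).
  { intros w Hw. apply Cmod_gt_0. intros E'. apply Hw.
    replace w with (z + (w - z)) by ring. rewrite E'. ring. }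
  rewrite is_Cderive_eps. split; intros H eps Heps.
  - destruct (H (eps / 2)%R ltac:(lra)) as [del [Hdel Hd]]. exists del; split; [exact Hdel|].
    intros w Hw Hwd. specialize (Hd w Hwd). rewrite E in Hd by exact Hw.
    apply Rmult_le_reg_r in Hd; [lra | auto].
  - destruct (H eps Heps) as [del [Hdel Hd]]. exists del; split; [exact Hdel|].
    intros w Hwd. destruct (classic (w = z)) as [->|Hw].
    + replace (f z - f z - (z - z) * l) with (RtoC 0) by ring.
      rewrite Cmod_0. pose proof (Cmod_ge_0 (z - z)). nra.
    + rewrite E by exact Hw. apply Rmult_le_compat_r; [apply Cmod_ge_0|]. apply Rlt_le, Hd; assumption.
Qed.

Lemma tends_id (a : C) : tends (pnbhd a) (fun z => z) a.
Proof. exact (tends_derivable (fun z => z) a 1 (is_Cderive_id a)). Qed.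

Lemma locally'_pnbhd (a : C) (P : C -> Prop) : locally' (T := C_UniformSpace) a P -> pnbhd a P.
Proof.
  intros [eps H]. exists eps. split; [apply cond_pos|]. intros z Hz Hd. apply H; [|exact Hz].
  apply C_NormedModule_mixin_compat1. exact Hd.
Qed.

Lemma filterlim_tends (g : C -> C) (a l : C) :
  filterlim g (locally' (T := C_UniformSpace) a) (locally (T := C_UniformSpace) l) ->
  tends (pnbhd a) g l.
Proof.
  intros H eps Heps. apply locally'_pnbhd. apply (H (fun w => (Cmod (w - l) < eps)%R)).
  apply locally_C. exists (mkposreal eps Heps). intros w Hw. exact Hw.
Qed.

Lemma pnbhd_shift (a b : C) (P : C -> Prop) : pnbhd (a + b) P -> pnbhd a (fun z => P (z + b)).
Proof.
  intros [del [Hdel H]]. exists del; split; [exact Hdel|]. intros z Hz Hd. apply H.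
  - intros E. apply Hz. replace z with (z + b - b) by ring. rewrite E. ring.
  - replace (z + b - (a + b)) with (z - a) by ring. exact Hd.
Qed.

Lemma pnbhd_opp (P : C -> Prop) : pnbhd 0 P -> pnbhd 0 (fun z => P (- z)).
Proof.
  intros [del [Hdel H]]. exists del; split; [exact Hdel|]. intros z Hz Hd. apply H.
  - intros E. apply Hz. replace z with (- - z) by ring. rewrite E. ring.
  - replace (- z - 0) with (- (z - 0)) by ring. rewrite Cmod_opp. exact Hd.
Qed.

(** * Uniqueness and constancy along segments *)

Lemma im_le_Cmod (z : C) : (Rabs (Im z) <= Cmod z)%R.
Proof. apply Rle_trans with (2 := Rmax_Cmod z). apply Rmax_r. Qed.

Lemma is_RCderive_Re (y : R -> C) (t : R) (l : C) :
  is_RCderive y t l -> is_derive (fun s => Re (y s)) t (Re l).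
Proof.
  intros H. apply (is_derive_eps (K := R_AbsRing) (V := R_NormedModule)). intros eps Heps.
  destruct (proj1 (is_RCderive_eps _ _ _) H eps Heps) as [del [Hdel Hd]].
  exists del; split; [exact Hdel|]. intros s Hs. specialize (Hd s Hs).
  eapply Rle_trans; [|exact Hd]. eapply Rle_trans; [|apply re_le_Cmod].
  change (Rabs (Re (y s) - Re (y t) - (s - t) * Re l) <= Rabs (Re (y s - y t - (s - t)%R * l)))%R.
  apply Req_le. f_equal. unfold Re; simpl. ring.
Qed.

Lemma is_RCderive_Im (y : R -> C) (t : R) (l : C) :
  is_RCderive y t l -> is_derive (fun s => Im (y s)) t (Im l).
Proof.
  intros H. apply (is_derive_eps (K := R_AbsRing) (V := R_NormedModule)). intros eps Heps.
  destruct (proj1 (is_RCderive_eps _ _ _) H eps Heps) as [del [Hdel Hd]].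
  exists del; split; [exact Hdel|]. intros s Hs. specialize (Hd s Hs).
  eapply Rle_trans; [|exact Hd]. eapply Rle_trans; [|apply im_le_Cmod].
  change (Rabs (Im (y s) - Im (y t) - (s - t) * Im l) <= Rabs (Im (y s - y t - (s - t)%R * l)))%R.
  apply Req_le. f_equal. unfold Im; simpl. ring.
Qed.

Lemma Cmod_le_Re_Im (z : C) : (Cmod z <= Rabs (Re z) + Rabs (Im z))%R.
Proof.
  pose proof (Cmod_ge_0 z). pose proof (Cmod2_alt z).
  pose proof (Rabs_pos (Re z)). pose proof (Rabs_pos (Im z)).
  pose proof (pow2_abs (Re z)). pose proof (pow2_abs (Im z)). nra.
Qed.

(** The function [e t * exp (- k * t)] is nonincreasing, so [e 1 * exp (- k)] is bounded by values
    [e t] that are arbitrarily small. Nothing is required at [t = 0], which may be a singular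
    point. *)
Lemma gronwall_zero (e de : R -> R) (k : R) :
  (forall t, (0 < t <= 1)%R -> is_derive e t (de t) /\ (de t <= k * e t)%R) ->
  (0 <= k)%R -> (forall t, (0 <= e t)%R) ->
  (forall eps, (0 < eps)%R -> exists t, (0 < t <= 1)%R /\ (e t < eps)%R) ->
  e 1%R = 0%R.
Proof.
  intros Hd Hk Hpos Hsmall.
  assert (Hmono : forall t, (0 < t <= 1)%R -> (e 1 * exp (- k * 1) <= e t * exp (- k * t))%R).
  { intros t Ht.
    set (phi := fun s => (e s * exp (- k * s))%R).
    set (dphi := fun s => (de s * exp (- k * s) + e s * (- k * exp (- k * s)))%R).
    assert (Hphi : forall s, (0 < s <= 1)%R -> is_derive phi s (dphi s)).
    { intros s Hs. apply (Derive.is_derive_mult e (fun u => exp (- k * u))%R); [apply Hd; exact Hs|].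
      auto_derive; [trivial|ring]. }
    destruct (MVT_gen phi t 1 dphi) as [c [Hc E]].
    - rewrite Rmin_left, Rmax_right by lra. intros x Hx. apply Hphi. lra.
    - rewrite Rmin_left, Rmax_right by lra. intros x Hx.
      apply continuity_pt_filterlim. apply (ex_derive_continuous (K := R_AbsRing) (V := R_NormedModule)).
      exists (dphi x). apply Hphi. lra.
    - rewrite Rmin_left, Rmax_right in Hc by lra.
      assert (dphi c <= 0)%R.
      { unfold dphi. destruct (Hd c ltac:(lra)) as [_ H]. pose proof (exp_pos (- k * c)). nra. }
      unfold phi in E. nra. }
  apply Rle_antisym; [|apply Hpos].
  apply Rnot_lt_le. intros H1.
  pose proof (exp_pos (- k * 1)) as He.
  destruct (Hsmall (e 1 * exp (- k * 1))%R ltac:(apply Rmult_lt_0_compat; lra)) as [t [Ht Hlt]].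
  specialize (Hmono t Ht).
  assert (exp (- k * t) <= 1)%R.
  { rewrite <- exp_0. destruct (Req_dec (- k * t) 0) as [->|Hn]; [lra|].
    apply Rlt_le, exp_increasing. nra. }
  pose proof (Hpos t). nra.
Qed.

(** The square is taken because [Cmod] is not differentiable at 0, the very value that the
    uniqueness arguments aim at. *)
Lemma is_derive_Cmod2 (y : R -> C) (t : R) (l : C) :
  is_RCderive y t l ->
  is_derive (fun s => (Cmod (y s) ^ 2)%R) t (2 * (Re (y t) * Re l + Im (y t) * Im l))%R.
Proof.
  intros H.
  apply (is_derive_ext (K := R_AbsRing) (V := R_NormedModule)
           (fun s => (Re (y s) * Re (y s) + Im (y s) * Im (y s))%R)).
  { intros s. rewrite Cmod2_alt. simpl. ring. }
  replace (2 * (Re (y t) * Re l + Im (y t) * Im l))%R with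
    ((Re l * Re (y t) + Re (y t) * Re l) + (Im l * Im (y t) + Im (y t) * Im l))%R by ring.
  apply (is_derive_plus (K := R_AbsRing) (V := R_NormedModule));
    [apply (Derive.is_derive_mult (fun s => Re (y s)) (fun s => Re (y s))); apply is_RCderive_Re
    |apply (Derive.is_derive_mult (fun s => Im (y s)) (fun s => Im (y s))); apply is_RCderive_Im]; exact H.
Qed.

Lemma Cmod_inner (a b : C) : (Re a * Re b + Im a * Im b <= Cmod a * Cmod b)%R.
Proof.
  pose proof (re_le_Cmod (a * Cconj b)) as H. rewrite Cmod_mult, Cmod_conj in H.
  pose proof (Rle_abs (Re (a * Cconj b))) as H'.
  replace (Re (a * Cconj b)) with (Re a * Re b + Im a * Im b)%R in * by (unfold Re, Im; simpl; ring).
  lra.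
Qed.

(* Nothing is assumed at [a] itself, so that [a] may be a singular point of the system. *)
Lemma ray_unique (y1 y2 y3 d1 d2 d3 : C -> C) (a b : C) (k : R) :
  (0 <= k)%R ->
  (forall t : R, (0 < t <= 1)%R ->
     let z := a + t * (b - a) in let n := (Cmod (y1 z) + Cmod (y2 z) + Cmod (y3 z))%R in
     (is_Cderive y1 z (d1 z) /\ Cmod (d1 z) <= k * n)%R /\
     (is_Cderive y2 z (d2 z) /\ Cmod (d2 z) <= k * n)%R /\
     (is_Cderive y3 z (d3 z) /\ Cmod (d3 z) <= k * n)%R) ->
  b <> a ->
  tends (pnbhd a) y1 0 -> tends (pnbhd a) y2 0 -> tends (pnbhd a) y3 0 ->
  y1 b = 0 /\ y2 b = 0 /\ y3 b = 0.
Proof.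
  intros Hk Hd Hba T1 T2 T3.
  set (p := fun t : R => a + t * (b - a)).
  assert (HB : (0 < Cmod (b - a))%R).
  { apply Cmod_gt_0. intros E. apply Hba. replace b with (a + (b - a)) by ring. rewrite E. ring. }
  set (B := Cmod (b - a)) in *.
  set (e := fun t => (Cmod (y1 (p t)) ^ 2 + Cmod (y2 (p t)) ^ 2 + Cmod (y3 (p t)) ^ 2)%R).
  (* By Cauchy-Schwarz the derivative of [e] is at most [2 k B (n1 + n2 + n3)^2], where [ni] is the
     modulus of the i-th component, and [(n1 + n2 + n3)^2] is at most [3 e]; hence the factor 6. *)
  assert (He : e 1%R = 0%R).
  { apply (gronwall_zero e
      (fun t => 2 * (Re (y1 (p t)) * Re (d1 (p t) * (b - a)) + Im (y1 (p t)) * Im (d1 (p t) * (b - a)))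
              + 2 * (Re (y2 (p t)) * Re (d2 (p t) * (b - a)) + Im (y2 (p t)) * Im (d2 (p t) * (b - a)))
              + 2 * (Re (y3 (p t)) * Re (d3 (p t) * (b - a)) + Im (y3 (p t)) * Im (d3 (p t) * (b - a))))%R
      (6 * k * B)%R).
    - intros t Ht. specialize (Hd t Ht). cbv zeta in Hd. fold (p t) in Hd.
      destruct Hd as [[D1 B1] [[D2 B2] [D3 B3]]]. split.
      + apply (is_derive_plus (K := R_AbsRing) (V := R_NormedModule));
          [apply (is_derive_plus (K := R_AbsRing) (V := R_NormedModule))|];
          apply is_derive_Cmod2, is_RCderive_path; assumption.
      + pose proof (Cmod_inner (y1 (p t)) (d1 (p t) * (b - a))) as I1.
        pose proof (Cmod_inner (y2 (p t)) (d2 (p t) * (b - a))) as I2.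
        pose proof (Cmod_inner (y3 (p t)) (d3 (p t) * (b - a))) as I3.
        rewrite Cmod_mult in I1, I2, I3. fold B in I1, I2, I3. unfold e.
        set (n1 := Cmod (y1 (p t))) in *. set (n2 := Cmod (y2 (p t))) in *. set (n3 := Cmod (y3 (p t))) in *.
        assert (P1 : (0 <= n1)%R) by apply Cmod_ge_0.
        assert (P2 : (0 <= n2)%R) by apply Cmod_ge_0.
        assert (P3 : (0 <= n3)%R) by apply Cmod_ge_0.
        assert (Q : forall n m, (0 <= n -> m <= k * (n1 + n2 + n3) ->
                     n * (m * B) <= n * (k * (n1 + n2 + n3) * B))%R).
        { intros n m Hn Hm. apply Rmult_le_compat_l; [exact Hn|]. apply Rmult_le_compat_r; lra. }
        pose proof (Q _ _ P1 B1). pose proof (Q _ _ P2 B2). pose proof (Q _ _ P3 B3).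
        assert (S : ((n1 + n2 + n3) * (n1 + n2 + n3) <= 3 * (n1 ^ 2 + n2 ^ 2 + n3 ^ 2))%R).
        { pose proof (pow2_ge_0 (n1 - n2)). pose proof (pow2_ge_0 (n1 - n3)).
          pose proof (pow2_ge_0 (n2 - n3)). nra. }
        assert (KB : (0 <= k * B)%R) by (apply Rmult_le_pos; lra).
        apply (Rmult_le_compat_l _ _ _ KB) in S.
        set (X1 := (Re (y1 (p t)) * _ + _)%R) in *.
        set (X2 := (Re (y2 (p t)) * _ + _)%R) in *.
        set (X3 := (Re (y3 (p t)) * _ + _)%R) in *.
        replace (n1 * (k * (n1 + n2 + n3) * B))%R with (k * B * (n1 * (n1 + n2 + n3)))%R in * by ring.
        replace (n2 * (k * (n1 + n2 + n3) * B))%R with (k * B * (n2 * (n1 + n2 + n3)))%R in * by ring.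
        replace (n3 * (k * (n1 + n2 + n3) * B))%R with (k * B * (n3 * (n1 + n2 + n3)))%R in * by ring.
        lra.
    - apply Rmult_le_pos; lra.
    - intros t. unfold e. pose proof (pow2_ge_0 (Cmod (y1 (p t)))).
      pose proof (pow2_ge_0 (Cmod (y2 (p t)))). pose proof (pow2_ge_0 (Cmod (y3 (p t)))). lra.
    - intros eps Heps. set (eta := Rmin 1 (eps / 3)).
      assert (Heta : (0 < eta)%R) by (apply Rmin_pos; lra).
      destruct (filter_and (F := pnbhd a) _ _ (T1 eta Heta)
                 (filter_and (F := pnbhd a) _ _ (T2 eta Heta) (T3 eta Heta))) as [del [Hdel H]].
      assert (Hq : (0 < del / (2 * B))%R) by (apply Rdiv_lt_0_compat; lra).
      assert (Ht : (0 < Rmin 1 (del / (2 * B)))%R) by (apply Rmin_pos; lra).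
      exists (Rmin 1 (del / (2 * B))). split; [split; [exact Ht | apply Rmin_l]|].
      set (t := Rmin 1 (del / (2 * B))) in *.
      assert (Hpt : p t - a = t * (b - a)) by (unfold p; ring).
      assert (Hm : (Cmod (p t - a) = t * B)%R).
      { rewrite Hpt, Cmod_mult, Cmod_R, Rabs_pos_eq by lra. reflexivity. }
      destruct (H (p t)) as [H1 [H2 H3]].
      + intros E. rewrite E in Hm. replace (a - a) with (RtoC 0) in Hm by ring.
        rewrite Cmod_0 in Hm. nra.
      + rewrite Hm. assert (t <= del / (2 * B))%R as Hle by apply Rmin_r.
        apply (Rmult_le_compat_r B) in Hle; [|lra].
        replace (del / (2 * B) * B)%R with (del / 2)%R in Hle by (field; lra). lra.
      + assert (G : forall z, (Cmod (z - 0) < eta)%R -> (Cmod z ^ 2 < eps / 3)%R).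
        { intros z Hz. replace (z - 0) with z in Hz by ring. pose proof (Cmod_ge_0 z).
          pose proof (Rmin_l 1 (eps / 3)). pose proof (Rmin_r 1 (eps / 3)). fold eta in H4, H5. nra. }
        apply G in H1, H2, H3. unfold e. lra. }
  unfold e in He. replace (p 1%R) with b in He by (unfold p; ring).
  pose proof (pow2_ge_0 (Cmod (y1 b))). pose proof (pow2_ge_0 (Cmod (y2 b))). pose proof (pow2_ge_0 (Cmod (y3 b))).
  split; [|split]; apply Cmod_eq_0; apply Rsqr_0_uniq; unfold Rsqr; lra.
Qed.

Lemma Cmod_segment_lt (z v w : C) (r t : R) :
  (Cmod (v - z) < r)%R -> (Cmod (w - z) < r)%R -> (0 <= t <= 1)%R ->
  (Cmod (v + t * (w - v) - z) < r)%R.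
Proof.
  intros Hv Hw Ht.
  replace (v + t * (w - v) - z) with (RtoC (1 - t) * (v - z) + t * (w - z)) by (rewrite RtoC_minus; ring).
  eapply Rle_lt_trans; [apply Cmod_triangle|].
  rewrite !Cmod_mult, !Cmod_R, !Rabs_pos_eq by lra.
  destruct (Req_dec t 0) as [->|Hn]; nra.
Qed.

(** At a regular point [v] continuity turns zero values into the zero limits that [ray_unique] asks
    for. Three components are what the addition theorem needs; smaller systems are padded with the
    zero function. *)
Lemma ball_unique (y1 y2 y3 d1 d2 d3 : C -> C) (z : C) (r k : R) :
  (0 <= k)%R ->
  (forall w, (Cmod (w - z) < r)%R ->
     let n := (Cmod (y1 w) + Cmod (y2 w) + Cmod (y3 w))%R in
     (is_Cderive y1 w (d1 w) /\ Cmod (d1 w) <= k * n)%R /\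
     (is_Cderive y2 w (d2 w) /\ Cmod (d2 w) <= k * n)%R /\
     (is_Cderive y3 w (d3 w) /\ Cmod (d3 w) <= k * n)%R) ->
  forall v w, (Cmod (v - z) < r)%R -> (Cmod (w - z) < r)%R ->
    y1 v = 0 -> y2 v = 0 -> y3 v = 0 -> y1 w = 0 /\ y2 w = 0 /\ y3 w = 0.
Proof.
  intros Hk Hd v w Hv Hw E1 E2 E3.
  destruct (classic (w = v)) as [->|Hne]; [auto|].
  destruct (Hd v Hv) as [[D1 _] [[D2 _] [D3 _]]].
  apply (ray_unique y1 y2 y3 d1 d2 d3 v w k); try assumption.
  - intros t Ht. apply Hd. apply Cmod_segment_lt; [assumption..|lra].
  - rewrite <- E1. exact (tends_derivable _ _ _ D1).
  - rewrite <- E2. exact (tends_derivable _ _ _ D2).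
  - rewrite <- E3. exact (tends_derivable _ _ _ D3).
Qed.

(** The mean value theorem fails for complex values and is applied to the real and the imaginary
    part separately, which costs the factor 2. *)
Lemma segment_mean_value (f df : C -> C) (a b : C) (eps : R) :
  (forall t : R, (0 <= t <= 1)%R ->
     is_Cderive f (a + t * (b - a)) (df (a + t * (b - a))) /\
     (Cmod (df (a + t * (b - a))%C) <= eps)%R) ->
  (Cmod (f b - f a) <= 2 * eps * Cmod (b - a))%R.
Proof.
  intros H. set (p := fun t : R => a + t * (b - a)).
  assert (Hpart : forall part : C -> R, (forall z, (Rabs (part z) <= Cmod z)%R) ->
    (forall t, (0 <= t <= 1)%R -> is_derive (fun s => part (f (p s))) t (part (df (p t) * (b - a)))) ->
    (Rabs (part (f b) - part (f a)) <= eps * Cmod (b - a))%R).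
  { intros part Hle Hder.
    destruct (MVT_gen (fun s => part (f (p s))) 0 1 (fun t => part (df (p t) * (b - a)))) as [c [Hc E]].
    - rewrite Rmin_left, Rmax_right by lra. intros x Hx. apply Hder. lra.
    - rewrite Rmin_left, Rmax_right by lra. intros x Hx.
      apply continuity_pt_filterlim. apply (ex_derive_continuous (K := R_AbsRing) (V := R_NormedModule)).
      eexists. apply Hder. lra.
    - rewrite Rmin_left, Rmax_right in Hc by lra.
      replace (p 1%R) with b in E by (unfold p; ring). replace (p 0%R) with a in E by (unfold p; ring).
      rewrite E. replace (1 - 0)%R with 1%R by ring. rewrite Rmult_1_r.
      eapply Rle_trans; [apply Hle|]. rewrite Cmod_mult. apply Rmult_le_compat_r; [apply Cmod_ge_0|].
      apply H. exact Hc. }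
  eapply Rle_trans; [apply Cmod_le_Re_Im|].
  assert (HRe : (Rabs (Re (f b - f a)) <= eps * Cmod (b - a))%R).
  { replace (Re (f b - f a)) with (Re (f b) - Re (f a))%R by (unfold Re; simpl; ring).
    apply Hpart; [exact re_le_Cmod|]. intros t Ht. apply is_RCderive_Re, is_RCderive_path, H, Ht. }
  assert (HIm : (Rabs (Im (f b - f a)) <= eps * Cmod (b - a))%R).
  { replace (Im (f b - f a)) with (Im (f b) - Im (f a))%R by (unfold Im; simpl; ring).
    apply Hpart; [exact im_le_Cmod|]. intros t Ht. apply is_RCderive_Im, is_RCderive_path, H, Ht. }
  lra.
Qed.

Lemma segment_const (f : C -> C) (a b : C) :
  (forall t : R, (0 <= t <= 1)%R -> is_Cderive f (a + t * (b - a)) 0) -> f b = f a.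
Proof.
  intros H.
  assert (E : (Cmod (f b - f a) <= 2 * 0 * Cmod (b - a))%R).
  { apply (segment_mean_value f (fun _ => 0)). intros t Ht. split; [apply H, Ht|]. rewrite Cmod_0. lra. }
  replace (f b) with (f a + (f b - f a)) by ring. rewrite (Cmod_eq_0 (f b - f a)); [ring|].
  pose proof (Cmod_ge_0 (f b - f a)). lra.
Qed.

(** * The complement of a lattice *)

(** Connectedness of the unit interval. Near the supremum [m] of the points satisfying [P] there is
    such a point, and the local hypothesis at [m] carries [P] to [Rmin 1 (m + del / 2)]; this cannot
    exceed [m], so it is 1. *)
Lemma unit_interval_propagate (P : R -> Prop) :
  (forall t, (0 <= t <= 1)%R -> exists del, (0 < del)%R /\
     forall s s', (0 <= s <= 1)%R -> (0 <= s' <= 1)%R ->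
       (Rabs (s - t) < del)%R -> (Rabs (s' - t) < del)%R -> P s -> P s') ->
  P 0%R -> P 1%R.
Proof.
  intros Hloc H0.
  set (S := fun t => (0 <= t <= 1)%R /\ P t).
  destruct (completeness S) as [m [Hub Hlub]].
  - exists 1%R. intros t [Ht _]. lra.
  - exists 0%R. split; [lra | exact H0].
  - assert (Hm0 : (0 <= m)%R) by (apply Hub; split; [lra | exact H0]).
    assert (Hm1 : (m <= 1)%R) by (apply Hlub; intros t [Ht _]; lra).
    destruct (Hloc m ltac:(lra)) as [del [Hdel Hd]].
    assert (Hs : exists s, (0 <= s <= 1)%R /\ P s /\ (Rabs (s - m) < del)%R).
    { apply NNPP. intros Hn. assert (Hb : is_upper_bound S (m - del)%R).
      { intros t [Ht HPt]. apply Rnot_lt_le. intros Hlt. apply Hn. exists t.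
        assert (t <= m)%R by (apply Hub; split; assumption).
        split; [exact Ht|]. split; [exact HPt|]. apply Rabs_def1; lra. }
      apply Hlub in Hb. lra. }
    destruct Hs as [s [Hs [HPs Hsm]]].
    set (t := Rmin 1 (m + del / 2)).
    assert (Htm : (m <= t)%R) by (apply Rmin_glb; lra).
    assert (Htd : (t <= m + del / 2)%R) by apply Rmin_r.
    assert (Ht1 : (t <= 1)%R) by apply Rmin_l.
    assert (HPt : P t).
    { apply (Hd s); [exact Hs | lra | exact Hsm | apply Rabs_def1; lra | exact HPs]. }
    assert (t <= m)%R by (apply Hub; split; [lra | exact HPt]).
    replace 1%R with t; [exact HPt|]. unfold t in *. unfold Rmin in *. destruct (Rle_dec 1 (m + del / 2)); lra.
Qed.

Lemma integers_isolated (x : R) :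
  exists del, (0 < del)%R /\ forall n : Z, (Rabs (IZR n - x) < del)%R -> IZR n = x.
Proof.
  destruct (archimed x) as [A1 A2]. set (u := up x) in *.
  (* Here [u - 1 <= x < u]. With equality [x] is an integer and 1 is a valid radius; otherwise the
     distance to the nearer of [u - 1] and [u] excludes all integers. *)
  destruct (Req_dec (IZR u - 1) x) as [E|Hn].
  - exists 1%R. split; [lra|]. intros n Hn. apply Rabs_def2 in Hn.
    assert (E' : x = IZR (u - 1)) by (rewrite minus_IZR; lra). rewrite E' in Hn |- *.
    f_equal. destruct Hn as [H1 H2]. rewrite <- minus_IZR in H1, H2. apply lt_IZR in H1.
    apply (lt_IZR (-1)) in H2. lia.
  - exists (Rmin (IZR u - x) (x - (IZR u - 1))). split; [apply Rmin_pos; lra|].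
    intros n Hd. exfalso.
    pose proof (Rmin_l (IZR u - x) (x - (IZR u - 1))). pose proof (Rmin_r (IZR u - x) (x - (IZR u - 1))).
    apply Rabs_def2 in Hd. assert (H1 : (IZR n < IZR u)%R) by lra.
    assert (H2 : (IZR (u - 1) < IZR n)%R) by (rewrite minus_IZR; lra).
    apply lt_IZR in H1, H2. lia.
Qed.

Definition integral (x : R) : Prop := exists n : Z, x = IZR n.

Lemma not_integral_half : ~ integral (/ 2)%R.
Proof.
  intros [n Hn]. assert (H1 : (IZR 0 < IZR n)%R) by (rewrite <- Hn; lra).
  assert (H2 : (IZR n < IZR 1)%R) by (rewrite <- Hn; lra). apply lt_IZR in H1, H2. lia.
Qed.

(** Cramer's rule: [Im (z * Cconj w2)] kills the real multiples of [w2], and [Im (z * Cconj w1)]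
    those of [w1]. The Lipschitz bound transports the isolation of the integers to [L]. *)
Lemma lattice_coordinates (L : C -> Prop) :
  is_lattice L -> exists (w1 w2 : C) (s t : C -> R) (B : R),
    (0 < B)%R /\
    (forall z, z = s z * w1 + t z * w2) /\
    (forall x y : R, s (x * w1 + y * w2) = x /\ t (x * w1 + y * w2) = y) /\
    (forall z z', (Rabs (s z - s z') <= B * Cmod (z - z'))%R /\
                  (Rabs (t z - t z') <= B * Cmod (z - z'))%R) /\
    (forall z, L z <-> integral (s z) /\ integral (t z)).
Proof.
  intros [w1 [w2 [Hdet HL]]].
  set (D := Im (w1 * Cconj w2)) in *.
  set (s := fun z => (Im (z * Cconj w2) / D)%R).
  set (t := fun z => (- (Im (z * Cconj w1) / D))%R).
  assert (Hst : forall x y : R, s (x * w1 + y * w2) = x /\ t (x * w1 + y * w2) = y).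
  { intros x y. unfold s, t, D in *. destruct w1 as [a b], w2 as [c d].
    unfold Im, Cconj, Cmult, Cplus, RtoC in *; simpl in *.
    split; field; lra. }
  assert (Hz : forall z, z = s z * w1 + t z * w2).
  { intros z. unfold s, t, D in *. destruct w1 as [a b], w2 as [c d], z as [x y].
    unfold Im, Cconj, Cmult, Cplus, RtoC in *; simpl in *.
    apply injective_projections; simpl; field; lra. }
  assert (HD : (0 < Rabs D)%R) by (apply Rabs_pos_lt; exact Hdet).
  assert (Hlip : forall w u : C, (Rabs (Im (u * Cconj w) / D) <= Cmod w / Rabs D * Cmod u)%R).
  { intros w u. unfold Rdiv. rewrite Rabs_mult, Rabs_inv.
    pose proof (im_le_Cmod (u * Cconj w)) as H. rewrite Cmod_mult, Cmod_conj in H.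
    apply (Rmult_le_compat_r (/ Rabs D)) in H; [lra|]. apply Rlt_le, Rinv_0_lt_compat, HD. }
  exists w1, w2, s, t, (Cmod w1 / Rabs D + Cmod w2 / Rabs D + 1)%R.
  assert (P1 : (0 <= Cmod w1 / Rabs D)%R) by (apply Rdiv_le_0_compat; [apply Cmod_ge_0 | exact HD]).
  assert (P2 : (0 <= Cmod w2 / Rabs D)%R) by (apply Rdiv_le_0_compat; [apply Cmod_ge_0 | exact HD]).
  split; [lra|]. split; [exact Hz|]. split; [exact Hst|]. split.
  - intros z z'. pose proof (Cmod_ge_0 (z - z')).
    split.
    + replace (s z - s z')%R with (Im ((z - z') * Cconj w2) / D)%R
        by (unfold s, Im, Cconj, Cmult, Cminus, Cplus, Copp; simpl; field; exact Hdet).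
      eapply Rle_trans; [apply Hlip|]. apply Rmult_le_compat_r; lra.
    + replace (t z - t z')%R with (- (Im ((z - z') * Cconj w1) / D))%R
        by (unfold t, Im, Cconj, Cmult, Cminus, Cplus, Copp; simpl; field; exact Hdet).
      rewrite Rabs_Ropp. eapply Rle_trans; [apply Hlip|]. apply Rmult_le_compat_r; lra.
  - intros z. rewrite HL. split.
    + intros [m [n ->]]. destruct (Hst (IZR m) (IZR n)) as [-> ->].
      split; [exists m | exists n]; reflexivity.
    + intros [[m Hm] [n Hn]]. exists m, n. rewrite <- Hm, <- Hn. apply Hz.
Qed.

Lemma lattice_isolated (L : C -> Prop) (z : C) : is_lattice L -> pnbhd z (fun v => ~ L v).
Proof.
  intros HL. destruct (lattice_coordinates L HL) as (w1 & w2 & s & t & B & HB & Hz & Hst & Hlip & HLst).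
  destruct (integers_isolated (s z)) as [e1 [He1 H1]].
  destruct (integers_isolated (t z)) as [e2 [He2 H2]].
  exists (Rmin (e1 / B) (e2 / B)). split; [apply Rmin_pos; apply Rdiv_lt_0_compat; lra|].
  intros v Hv Hd HLv. apply Hv. apply HLst in HLv. destruct HLv as [[m Hm] [n Hn]].
  destruct (Hlip v z) as [L1 L2].
  assert (D1 := Rlt_le_trans _ _ _ Hd (Rmin_l _ _)). assert (D2 := Rlt_le_trans _ _ _ Hd (Rmin_r _ _)).
  apply Rlt_div_r in D1, D2; [|exact HB..].
  rewrite (Hz v), (Hz z), Hm, Hn. rewrite Hm in L1. rewrite Hn in L2.
  rewrite (H1 m), (H2 n); [reflexivity|lra|lra].
Qed.

Lemma lattice_closed (L : C -> Prop) (z : C) :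
  is_lattice L -> ~ L z -> exists r, (0 < r)%R /\ forall v, (Cmod (v - z) < r)%R -> ~ L v.
Proof.
  intros HL Hz. destruct (lattice_isolated L z HL) as [r [Hr H]]. exists r; split; [exact Hr|].
  intros v Hv. destruct (classic (v = z)) as [->|Hne]; [exact Hz | auto].
Qed.

Lemma lattice_plus (L : C -> Prop) (a b : C) : is_lattice L -> L a -> L b -> L (a + b).
Proof.
  intros [w1 [w2 [_ HL]]] Ha Hb. apply HL in Ha, Hb.
  destruct Ha as [m [n ->]], Hb as [m' [n' ->]]. apply HL. exists (m + m')%Z, (n + n')%Z.
  rewrite !plus_IZR, !RtoC_plus. ring.
Qed.

Lemma lattice_opp (L : C -> Prop) (a : C) : is_lattice L -> L a -> L (- a).
Proof.
  intros [w1 [w2 [_ HL]]] Ha. apply HL in Ha.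
  destruct Ha as [m [n ->]]. apply HL. exists (- m)%Z, (- n)%Z.
  rewrite !opp_IZR, !RtoC_opp. ring.
Qed.

Lemma lattice_zero (L : C -> Prop) : is_lattice L -> L 0.
Proof. intros [w1 [w2 [_ HL]]]. apply HL. exists 0%Z, 0%Z. ring. Qed.

Lemma lattice_shift (L : C -> Prop) (z w : C) : is_lattice L -> L w -> L (z + w) <-> L z.
Proof.
  intros HL Hw. split; intros H; [|apply lattice_plus; assumption].
  replace z with (z + w + - w) by ring. apply lattice_plus; [assumption..|]. apply lattice_opp; assumption.
Qed.

Lemma lattice_opp_iff (L : C -> Prop) (z : C) : is_lattice L -> L (- z) <-> L z.
Proof.
  intros HL. split; intros H; [|apply lattice_opp; assumption].
  replace z with (- - z) by ring. apply lattice_opp; assumption.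
Qed.

(* In lattice coordinates, any point off [L] reaches the centre of a cell by one horizontal and one
   vertical segment avoiding [L]. *)
Lemma lattice_compl_propagate (L : C -> Prop) (P : C -> Prop) :
  is_lattice L ->
  (forall z, ~ L z -> exists r, (0 < r)%R /\
     forall v w, (Cmod (v - z) < r)%R -> (Cmod (w - z) < r)%R -> P v -> P w) ->
  forall a b, ~ L a -> ~ L b -> P a -> P b.
Proof.
  intros HL Hloc.
  assert (Hseg : forall a b, (forall x : R, (0 <= x <= 1)%R -> ~ L (a + x * (b - a))) -> P a -> P b).
  { intros a b Hab Ha.
    replace b with (a + 1%R * (b - a)) by ring.
    apply (unit_interval_propagate (fun x : R => P (a + x * (b - a)))).
    - intros x Hx. destruct (Hloc _ (Hab x Hx)) as [r [Hr H]].
      pose proof (Cmod_ge_0 (b - a)).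
      exists (r / (Cmod (b - a) + 1))%R. split; [apply Rdiv_lt_0_compat; lra|].
      assert (Q : forall y : R, (Rabs (y - x) < r / (Cmod (b - a) + 1))%R ->
                  (Cmod (a + y * (b - a) - (a + x * (b - a))) < r)%R).
      { intros y Hy. apply Rlt_div_r in Hy; [|lra].
        replace (a + y * (b - a) - (a + x * (b - a))) with (RtoC (y - x) * (b - a)) by (rewrite RtoC_minus; ring).
        rewrite Cmod_mult, Cmod_R. pose proof (Rabs_pos (y - x)). nra. }
      intros y y' _ _ Hy Hy'. apply H; apply Q; assumption.
    - replace (a + 0%R * (b - a)) with a by ring. exact Ha. }
  assert (Hseg2 : forall a b, (forall x : R, (0 <= x <= 1)%R -> ~ L (a + x * (b - a))) -> (P a <-> P b)).
  { intros a b Hab. split; [apply Hseg; exact Hab|]. apply Hseg. intros x Hx.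
    replace (b + x * (a - b)) with (a + (1 - x)%R * (b - a)) by (rewrite RtoC_minus; ring). apply Hab. lra. }
  destruct (lattice_coordinates L HL) as (w1 & w2 & s & t & B & HB & Hz & Hst & Hlip & HLst).
  set (pt := fun x y : R => x * w1 + y * w2).
  assert (HLpt : forall x y, L (pt x y) <-> integral x /\ integral y).
  { intros x y. rewrite HLst. unfold pt. destruct (Hst x y) as [-> ->]. reflexivity. }
  assert (Hv : forall x y y', ~ integral x -> (P (pt x y) <-> P (pt x y'))).
  { intros x y y' Hx. apply Hseg2. intros u _.
    replace (pt x y + u * (pt x y' - pt x y)) with (pt x (y + u * (y' - y))%R)
      by (unfold pt; rewrite RtoC_plus, RtoC_mult, RtoC_minus; ring).
    rewrite HLpt. tauto. }
  assert (Hh : forall x x' y, ~ integral y -> (P (pt x y) <-> P (pt x' y))).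
  { intros x x' y Hy. apply Hseg2. intros u _.
    replace (pt x y + u * (pt x' y - pt x y)) with (pt (x + u * (x' - x))%R y)
      by (unfold pt; rewrite RtoC_plus, RtoC_mult, RtoC_minus; ring).
    rewrite HLpt. tauto. }
  assert (Hbase : forall z, ~ L z -> (P z <-> P (pt (/ 2)%R (/ 2)%R))).
  { intros z HLz. rewrite (Hz z) at 1. fold (pt (s z) (t z)).
    pose proof not_integral_half as Hhalf.
    (* The first segment must run along a line whose fixed coordinate is not an integer. If [s z] is
       an integer then [t z] is not, and the horizontal segment comes first. *)
    destruct (classic (integral (s z))) as [Hs|Hs].
    - assert (Ht : ~ integral (t z)) by (rewrite HLst in HLz; tauto).
      rewrite (Hh (s z) (/ 2)%R (t z) Ht). apply Hv. exact Hhalf.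
    - rewrite (Hv (s z) (t z) (/ 2)%R Hs). apply Hh. exact Hhalf. }
  intros a b Ha Hb. rewrite (Hbase a Ha), (Hbase b Hb). trivial.
Qed.

Lemma lattice_compl_const (L : C -> Prop) (f : C -> C) :
  is_lattice L -> (forall z, ~ L z -> is_Cderive f z 0) ->
  forall a b, ~ L a -> ~ L b -> f a = f b.
Proof.
  intros HL Hf a b Ha Hb. symmetry.
  apply (lattice_compl_propagate L (fun z => f z = f a) HL) with (a := a); trivial.
  intros z Hz. destruct (lattice_closed L z HL Hz) as [r [Hr H]]. exists r; split; [exact Hr|].
  intros v w Hv Hw <-. apply segment_const. intros t Ht. apply Hf, H. apply Cmod_segment_lt; assumption.
Qed.

(** Differentiates by the shape of the function and searches the hypotheses at the leaves. The
    result is not simplified, hence the frequent use of [is_Cderive_eq] before it. *)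
Ltac cderive :=
  lazymatch goal with
  | |- is_Cderive (fun _ => ?a) _ _ => apply (is_Cderive_const a)
  | |- is_Cderive (fun w => w) _ _ => apply is_Cderive_id
  | |- is_Cderive (fun w => @?f w + @?g w) _ _ => apply (is_Cderive_plus f g); cderive
  | |- is_Cderive (fun w => @?f w - @?g w) _ _ => apply (is_Cderive_minus f g); cderive
  | |- is_Cderive (fun w => @?f w * @?g w) _ _ => apply (is_Cderive_mult f g); cderive
  | |- is_Cderive (fun w => - @?f w) _ _ => apply (is_Cderive_opp f); cderive
  | |- is_Cderive (fun w => / @?f w) _ _ => apply (is_Cderive_inv f); [cderive | try assumption]
  | |- is_Cderive _ ?z _ =>
      multimatch goal with
      | H : is_Cderive ?f z _ |- is_Cderive ?f _ _ => exact H
      | H : forall u, _ -> is_Cderive ?f u _ |- is_Cderive ?f _ _ => apply H; assumption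
      end
  end.

(** * The second-order equation and the evenness of the Weierstrass function *)

Lemma is_Cderive_locally_bounded (f : C -> C) (z l : C) :
  is_Cderive f z l ->
  exists r, (0 < r)%R /\ forall w, (Cmod (w - z) < r)%R -> (Cmod (f w) <= Cmod (f z) + 1)%R.
Proof.
  intros H. destruct (tends_bounded (pnbhd z) f (f z) (tends_derivable _ _ _ H)) as [r [Hr Hb]].
  exists r; split; [exact Hr|]. intros w Hw. destruct (classic (w = z)) as [->|Hn]; [lra|].
  apply Rlt_le, Hb; assumption.
Qed.

(** The tool for differentiating an identity that holds on an open set. *)
Lemma is_Cderive_zero_near (f : C -> C) (z l : C) :
  (exists r, (0 < r)%R /\ forall w, (Cmod (w - z) < r)%R -> f w = 0) -> is_Cderive f z l -> l = 0.
Proof.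
  intros [r [Hr H]] Hl. apply (is_Cderive_unique f z); [exact Hl|].
  apply (is_Cderive_ext_near (fun _ => 0) f z 0 r Hr); [|apply is_Cderive_const].
  intros w Hw. symmetry. auto.
Qed.

(** The second-order equation gives uniqueness; the first-order one fixes [g3], and it removes the
    square of [F1] from the equation of the reciprocal. *)
Definition weierstrass_ode_at (g2 g3 : C) (F F1 : C -> C) (z : C) : Prop :=
  is_Cderive F z (F1 z) /\ is_Cderive F1 z (6 * (F z * F z) - g2 / 2) /\
  F1 z * F1 z = 4 * (F z * F z * F z) - g2 * F z - g3.

(** The second expression is half the derivative of the cubic, so its vanishing would make [x] a
    double root. *)
Lemma disc_double_root (g2 g3 x : C) :
  g2 * g2 * g2 - 27 * (g3 * g3) <> 0 ->
  4 * (x * x * x) - g2 * x - g3 = 0 -> 6 * (x * x) - g2 / 2 <> 0.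
Proof.
  intros Hd H1 H2. apply Hd.
  assert (E : g2 = 12 * (x * x)).
  { replace g2 with (12 * (x * x) - 2 * (6 * (x * x) - g2 / 2)) by field. rewrite H2. ring. }
  assert (E3 : g3 = 4 * (x * x * x) - g2 * x).
  { replace g3 with (4 * (x * x * x) - g2 * x - (4 * (x * x * x) - g2 * x - g3)) by ring. rewrite H1. ring. }
  rewrite E3, E. ring.
Qed.

(** Differentiating the first-order equation only gives [v * wp' = 0] for the defect [v] of the
    second-order equation. Two further derivatives of this product force [v' = 0] at every point, so
    [v] is constant off [L]; a nonzero constant would make [wp] constant, against its pole. *)
Lemma weierstrass_second_order (g2 g3 : C) (L : C -> Prop) (wp zeta sigma : C -> C) :
  g2 * g2 * g2 - 27 * (g3 * g3) <> 0 ->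
  weierstrass g2 g3 L wp zeta sigma ->
  exists wp1 : C -> C, forall z, ~ L z -> weierstrass_ode_at g2 g3 wp wp1 z.
Proof.
  intros Hdisc HW. pose proof (w_lattice _ _ _ _ _ _ HW) as HL.
  destruct (wp_holomorphic _ _ _ _ _ _ HW) as [D [HD0 HD]].
  assert (HD' : forall n z, ~ L z -> is_Cderive (D n) z (D (S n) z)) by exact HD. clear HD.
  assert (Hnear : forall (f : C -> C), (forall z, ~ L z -> f z = 0) ->
            forall z l, ~ L z -> is_Cderive f z l -> l = 0).
  { intros f Hf z l Hz. apply is_Cderive_zero_near.
    destruct (lattice_closed L z HL Hz) as [r [Hr H]]. exists r; split; [exact Hr | auto]. }
  assert (Hp : exists p0 p1 p2 p3 p4 : C -> C, forall z, ~ L z ->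
     p0 z = wp z /\ is_Cderive p0 z (p1 z) /\ is_Cderive p1 z (p2 z) /\
     is_Cderive p2 z (p3 z) /\ is_Cderive p3 z (p4 z)).
  { exists (D 0%nat), (D 1%nat), (D 2%nat), (D 3%nat), (D 4%nat). intros z Hz.
    split; [apply HD0, Hz|]. repeat split; apply HD', Hz. }
  destruct Hp as (p0 & p1 & p2 & p3 & p4 & Hp). clear HD' HD0 D.
  assert (Ewp : forall z, ~ L z -> p0 z = wp z) by (intros z Hz; apply Hp, Hz).
  assert (d0 : forall z, ~ L z -> is_Cderive p0 z (p1 z)) by (intros z Hz; apply Hp, Hz).
  assert (d1 : forall z, ~ L z -> is_Cderive p1 z (p2 z)) by (intros z Hz; apply Hp, Hz).
  assert (d2 : forall z, ~ L z -> is_Cderive p2 z (p3 z)) by (intros z Hz; apply Hp, Hz).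
  assert (d3 : forall z, ~ L z -> is_Cderive p3 z (p4 z)) by (intros z Hz; apply Hp, Hz).
  clear Hp.
  assert (Hwp : forall z, ~ L z -> is_Cderive wp z (p1 z)).
  { intros z Hz. destruct (lattice_closed L z HL Hz) as [r [Hr H]].
    apply (is_Cderive_ext_near p0 wp z _ r Hr); [|apply d0, Hz].
    intros w Hw. apply Ewp. auto. }
  assert (A : forall z, ~ L z -> p1 z * p1 z - (4 * (p0 z * p0 z * p0 z) - g2 * p0 z - g3) = 0).
  { intros z Hz. destruct (wp_ode _ _ _ _ _ _ HW z Hz) as [p [Hp Ep]].
    rewrite (is_Cderive_unique _ _ _ _ Hp (Hwp z Hz)) in Ep.
    rewrite <- (Ewp z Hz) in Ep. rewrite Ep. ring. }
  set (v := fun z => 6 * (p0 z * p0 z) - g2 / 2 - p2 z).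
  set (v1 := fun z => 12 * (p0 z * p1 z) - p3 z).
  set (v2 := fun z => 12 * (p1 z * p1 z + p0 z * p2 z) - p4 z).
  assert (dv : forall z, ~ L z -> is_Cderive v z (v1 z)).
  { intros z Hz. eapply is_Cderive_eq; [unfold v; cderive|unfold v1; ring]. }
  assert (dv1 : forall z, ~ L z -> is_Cderive v1 z (v2 z)).
  { intros z Hz. eapply is_Cderive_eq; [unfold v1; cderive|unfold v2; ring]. }
  assert (B : forall z, ~ L z -> v z * p1 z = 0).
  { intros z Hz.
    assert (E := Hnear _ A z _ Hz ltac:(cderive)). simpl in E.
    replace (v z * p1 z) with (- / 2 * (2 * (p2 z * p1 z) - (12 * (p0 z * p0 z) - g2) * p1 z))
      by (unfold v; field).
    replace (2 * (p2 z * p1 z) - (12 * (p0 z * p0 z) - g2) * p1 z) with (RtoC 0); [ring|].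
    rewrite <- E. ring. }
  assert (Cc : forall z, ~ L z -> v1 z * p1 z + v z * p2 z = 0).
  { intros z Hz. apply (Hnear _ B z _ Hz). cderive. }
  assert (Dd : forall z, ~ L z -> v2 z * p1 z + 2 * (v1 z * p2 z) + v z * p3 z = 0).
  { intros z Hz. rewrite <- (Hnear _ Cc z _ Hz ltac:(cderive)). ring. }
  (* Where [v = 0] and [p1] is nonzero, [Cc] gives the claim. Where [v = p1 = 0], [p2] is nonzero by
     the discriminant and [Dd] gives it. Where [v] is nonzero, [p1 = p2 = p3 = 0], and [v1] vanishes
     by its definition. *)
  assert (V1 : forall z, ~ L z -> v1 z = 0).
  { intros z Hz. specialize (A z Hz). specialize (B z Hz). specialize (Cc z Hz). specialize (Dd z Hz).
    destruct (Cmult_integral _ _ B) as [Ev|Ep].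
    - rewrite Ev in Cc, Dd. destruct (classic (p1 z = 0)) as [Ep|Ep].
      + rewrite Ep in A, Dd.
        assert (E2 : p2 z = 6 * (p0 z * p0 z) - g2 / 2).
        { replace (p2 z) with (6 * (p0 z * p0 z) - g2 / 2 - v z) by (unfold v; ring). rewrite Ev. ring. }
        assert (N : p2 z <> 0).
        { rewrite E2. apply (disc_double_root g2 g3); [exact Hdisc|].
          replace (RtoC 0) with (- RtoC 0) by ring. rewrite <- A. ring. }
        replace (v1 z) with ((v2 z * 0 + 2 * (v1 z * p2 z) + 0 * p3 z) / (2 * p2 z)) by (field; exact N).
        rewrite Dd. field. exact N.
      + replace (v1 z) with ((v1 z * p1 z + 0 * p2 z) / p1 z) by (field; exact Ep).
        rewrite Cc. field. exact Ep.
    - rewrite Ep in Cc, Dd. destruct (classic (v z = 0)) as [Ev|Ev].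
      + rewrite Ev in Dd.
        assert (N : p2 z <> 0).
        { replace (p2 z) with (6 * (p0 z * p0 z) - g2 / 2 - v z) by (unfold v; ring). rewrite Ev.
          replace (6 * (p0 z * p0 z) - g2 / 2 - 0) with (6 * (p0 z * p0 z) - g2 / 2) by ring.
          apply (disc_double_root g2 g3); [exact Hdisc|].
          replace (RtoC 0) with (- RtoC 0) by ring. rewrite <- A, Ep. ring. }
        replace (v1 z) with ((v2 z * 0 + 2 * (v1 z * p2 z) + 0 * p3 z) / (2 * p2 z)) by (field; exact N).
        rewrite Dd. field. exact N.
      + assert (E2 : p2 z = 0).
        { replace (p2 z) with ((v1 z * 0 + v z * p2 z) / v z) by (field; exact Ev). rewrite Cc. field. exact Ev. }
        assert (E3 : p3 z = 0).
        { replace (p3 z) with ((v2 z * 0 + 2 * (v1 z * 0) + v z * p3 z) / v z) by (field; exact Ev).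
          rewrite <- E2 at 2. rewrite Dd. field. exact Ev. }
        unfold v1. rewrite Ep, E3. ring. }
  (* If the constant [v] is nonzero then [p1 = 0] everywhere, [wp] is constant, and [z^2 wp z] tends
     to 0 instead of 1. *)
  assert (V0 : forall z, ~ L z -> v z = 0).
  { intros z Hz. apply NNPP. intros Hv.
    assert (Hc : forall w, ~ L w -> v w = v z).
    { intros w Hw. apply (lattice_compl_const L v HL); [|assumption..].
      intros u Hu. rewrite <- (V1 u Hu). auto. }
    assert (P1 : forall w, ~ L w -> p1 w = 0).
    { intros w Hw. destruct (Cmult_integral _ _ (B w Hw)) as [E|E]; [|exact E].
      rewrite (Hc w Hw) in E. contradiction. }
    assert (P0 : forall w, ~ L w -> wp w = p0 z).
    { intros w Hw. rewrite <- (Ewp w Hw). apply (lattice_compl_const L p0 HL); [|assumption..].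
      intros u Hu. rewrite <- (P1 u Hu). auto. }
    assert (T : tends (pnbhd 0) (fun w => w * w * wp w) (0 * 0 * p0 z)).
    { apply tends_ext with (f := fun w => w * w * p0 z); [typeclasses eauto| |].
      - generalize (lattice_isolated L 0 HL). apply filter_imp. intros w Hw. rewrite P0 by exact Hw. reflexivity.
      - apply tends_mult; [typeclasses eauto| |apply tends_const; typeclasses eauto].
        apply tends_mult; [typeclasses eauto| |]; apply tends_id. }
    pose proof (filterlim_tends _ _ _ (wp_pole _ _ _ _ _ _ HW)) as T1.
    assert (E := tends_unique (pnbhd 0) _ _ _ T T1). apply C1_nz. rewrite <- E. ring. }
  exists p1. intros z Hz. split; [apply Hwp, Hz|]. split.
  - eapply is_Cderive_eq; [apply d1, Hz|]. rewrite <- (Ewp z Hz).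
    replace (p2 z) with (6 * (p0 z * p0 z) - g2 / 2 - v z) by (unfold v; ring). rewrite (V0 z Hz). ring.
  - rewrite <- (Ewp z Hz).
    replace (p1 z * p1 z) with (p1 z * p1 z - (4 * (p0 z * p0 z * p0 z) - g2 * p0 z - g3)
      + (4 * (p0 z * p0 z * p0 z) - g2 * p0 z - g3)) by ring. rewrite (A z Hz). ring.
Qed.

(** * Solutions with a double pole *)

Lemma tends_zero_of_square (F : (C -> Prop) -> Prop) {HF : ProperFilter F} (f : C -> C) :
  tends F (fun z => f z * f z) 0 -> tends F f 0.
Proof.
  intros H eps Heps. generalize (H (eps * eps)%R ltac:(apply Rmult_lt_0_compat; lra)).
  apply filter_imp. intros z Hz.
  replace (f z * f z - 0) with ((f z - 0) * (f z - 0)) in Hz by ring. rewrite Cmod_mult in Hz.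
  pose proof (Cmod_ge_0 (f z - 0)). nra.
Qed.

(* [s'] tends to 0 because [s'^2 = 4s - g2 s^3 - g3 s^4]. *)
Lemma reciprocal_at_pole (g2 g3 : C) (F F1 : C -> C) :
  pnbhd 0 (weierstrass_ode_at g2 g3 F F1) -> tends (pnbhd 0) (fun z => z * z * F z) 1 ->
  let s := fun z => / F z in let s1 := fun z => - F1 z * (s z * s z) in
  pnbhd 0 (fun z => F z <> 0 /\ is_Cderive s z (s1 z) /\
    is_Cderive s1 z (2 - 3 / 2 * g2 * (s z * s z) - 2 * g3 * (s z * s z * s z))) /\
  tends (pnbhd 0) s 0 /\ tends (pnbhd 0) s1 0.
Proof.
  intros Hode HT s s1.
  assert (Hne : pnbhd 0 (fun z => F z <> 0)).
  { generalize (tends_neq (pnbhd 0) _ _ 0 HT C1_nz). apply filter_imp. intros z Hz E.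
    apply Hz. rewrite E. ring. }
  assert (Ts : tends (pnbhd 0) s 0).
  { apply tends_ext with (f := fun z => z * z * / (z * z * F z)); [typeclasses eauto| |].
    - destruct Hne as [r [Hr H]]. exists r; split; [exact Hr|]. intros z Hz Hd.
      specialize (H z Hz Hd). unfold s. field. auto.
    - apply (tends_eq _ _ (0 * 0 * / 1)); [|ring].
      apply tends_mult; [typeclasses eauto| |apply tends_inv; [typeclasses eauto|exact HT|apply C1_nz]].
      apply tends_mult; [typeclasses eauto|apply tends_id..]. }
  split; [|split; [exact Ts|]].
  - generalize (filter_and (F := pnbhd 0) _ _ Hne Hode). apply filter_imp.
    intros z [Hz [H1 [H2 H3]]]. split; [exact Hz|].
    assert (Hs : is_Cderive s z (s1 z)).
    { eapply is_Cderive_eq; [apply is_Cderive_inv; eassumption|]. unfold s1, s. field. exact Hz. }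
    split; [exact Hs|].
    eapply is_Cderive_eq; [unfold s1; cderive|]. unfold s1.
    (* This is [s'' = - F'' s^2 + 2 F'^2 s^3]. The first-order equation turns [F'^2 s^3] into
       [4 - g2 s^2 - g3 s^3], which leaves a polynomial in [s]. *)
    replace (- (6 * (F z * F z) - g2 / 2) * (s z * s z) +
             - F1 z * (- F1 z * (s z * s z) * s z + s z * (- F1 z * (s z * s z))))
      with (- (6 * (F z * F z) - g2 / 2) * (s z * s z) + 2 * (F1 z * F1 z) * (s z * s z * s z)) by ring.
    rewrite H3. unfold s. field. exact Hz.
  - apply tends_zero_of_square; [typeclasses eauto|].
    apply tends_ext with (f := fun z => s z * (4 - g2 * (s z * s z) - g3 * (s z * s z * s z)));
      [typeclasses eauto| |].
    + generalize (filter_and (F := pnbhd 0) _ _ Hne Hode). apply filter_imp.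
      intros z [Hz [H1 [H2 H3]]]. unfold s1.
      replace (- F1 z * (s z * s z) * (- F1 z * (s z * s z)))
        with (F1 z * F1 z * (s z * s z * s z * s z)) by ring.
      rewrite H3. unfold s. field. exact Hz.
    + apply (tends_eq _ _ (0 * (4 - g2 * (0 * 0) - g3 * (0 * 0 * 0)))); [|ring].
      repeat first [exact Ts | apply tends_const; typeclasses eauto
        | apply tends_minus; [typeclasses eauto| |] | apply tends_mult; [typeclasses eauto| |]].
Qed.

(** Both reciprocals solve the same regular equation and start at the pole with value and slope
    tending to 0; their difference solves a linear equation with bounded coefficient, so it vanishes
    on every ray from 0. *)
Lemma pole_unique (g2 g3 : C) (F F1 H H1 : C -> C) :
  pnbhd 0 (weierstrass_ode_at g2 g3 F F1) -> tends (pnbhd 0) (fun z => z * z * F z) 1 ->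
  pnbhd 0 (weierstrass_ode_at g2 g3 H H1) -> tends (pnbhd 0) (fun z => z * z * H z) 1 ->
  pnbhd 0 (fun z => F z = H z).
Proof.
  intros OF TF OH TH.
  destruct (reciprocal_at_pole g2 g3 F F1 OF TF) as [DF [Ts Ts1]].
  destruct (reciprocal_at_pole g2 g3 H H1 OH TH) as [DH [Tu Tu1]].
  set (s := fun z => / F z) in *. set (s1 := fun z => - F1 z * (s z * s z)) in *.
  set (u := fun z => / H z) in *. set (u1 := fun z => - H1 z * (u z * u z)) in *.
  destruct (filter_and (F := pnbhd 0) _ _ (filter_and (F := pnbhd 0) _ _ DF DH)
    (filter_and (F := pnbhd 0) _ _ (tends_bounded (pnbhd 0) _ _ Ts) (tends_bounded (pnbhd 0) _ _ Tu)))
    as [r [Hr Hall]].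
  exists r; split; [exact Hr|]. intros b Hb Hbr.
  (* The factor left when [s - u] is divided out of the difference of the two right-hand sides. As
     [s] and [u] have modulus below 1, it is bounded by [3 |g2| + 6 |g3|]; the 1 in [k] serves the
     first component. *)
  set (c1 := fun z => - (3 / 2 * g2 * (s z + u z)) - 2 * g3 * (s z * s z + s z * u z + u z * u z)).
  set (k := (1 + 3 * Cmod g2 + 6 * Cmod g3)%R).
  assert (Hk : (1 <= k)%R) by (pose proof (Cmod_ge_0 g2); pose proof (Cmod_ge_0 g3); unfold k; lra).
  assert (E : s b - u b = 0).
  { apply (ray_unique (fun z => s z - u z) (fun z => s1 z - u1 z) (fun _ => 0)
      (fun z => s1 z - u1 z) (fun z => c1 z * (s z - u z)) (fun _ => 0) 0 b k); [lra| |exact Hb|..].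
    - intros t Ht z n.
      assert (Ez : z = t * b) by (unfold z; ring).
      assert (Hz0 : z <> 0).
      { rewrite Ez. apply Cmult_neq_0; [|exact Hb]. intros E. apply RtoC_inj in E. lra. }
      assert (Hzr : (Cmod (z - 0) < r)%R).
      { replace (z - 0) with (t * b) by (rewrite Ez; ring). replace (b - 0) with b in Hbr by ring.
        rewrite Cmod_mult, Cmod_R, Rabs_pos_eq by lra. pose proof (Cmod_ge_0 b). nra. }
      destruct (Hall z Hz0 Hzr) as [[[NF [E1 E2]] [NH [G1 G2]]] [Bs Bu]].
      rewrite Cmod_0, Rplus_0_l in Bs, Bu.
      pose proof (Cmod_ge_0 (s z - u z)) as P1. pose proof (Cmod_ge_0 (s1 z - u1 z)) as P2.
      assert (Hn : n = (Cmod (s z - u z) + Cmod (s1 z - u1 z))%R) by (unfold n; rewrite Cmod_0; ring).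
      split; [|split].
      + split; [apply is_Cderive_minus; assumption|]. rewrite Hn. nra.
      + split.
        * eapply is_Cderive_eq; [apply is_Cderive_minus; eassumption|]. unfold c1, s, u. field. split; assumption.
        * rewrite Cmod_mult, Hn.
          assert (Hc : (Cmod (c1 z) <= k)%R).
          { assert (B1 : (Cmod (s z + u z) <= 2)%R).
            { eapply Rle_trans; [apply Cmod_triangle|]. lra. }
            assert (B2 : forall x y, (Cmod x < 1 -> Cmod y < 1 -> Cmod (x * y) <= 1)%R).
            { intros x y Hx Hy. rewrite Cmod_mult. pose proof (Cmod_ge_0 x). pose proof (Cmod_ge_0 y). nra. }
            assert (B3 : (Cmod (s z * s z + s z * u z + u z * u z) <= 3)%R).
            { eapply Rle_trans; [apply Cmod_triangle|].
              pose proof (Cmod_triangle (s z * s z) (s z * u z)).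
              pose proof (B2 _ _ Bs Bs). pose proof (B2 _ _ Bs Bu). pose proof (B2 _ _ Bu Bu). lra. }
            unfold c1, Cminus. eapply Rle_trans; [apply Cmod_triangle|].
            rewrite !Cmod_opp, !Cmod_mult.
            replace (3 / 2) with (RtoC (3 / 2)) by (rewrite RtoC_div by lra; reflexivity).
            rewrite !Cmod_R, !Rabs_pos_eq by lra.
            pose proof (Cmod_ge_0 g2). pose proof (Cmod_ge_0 g3). unfold k.
            apply (Rmult_le_compat_l (Cmod g2)) in B1; [|assumption].
            apply (Rmult_le_compat_l (Cmod g3)) in B3; [|assumption]. lra. }
          apply (Rmult_le_compat_r (Cmod (s z - u z))) in Hc; [|assumption]. nra.
      + split; [apply is_Cderive_const|]. rewrite Cmod_0, Hn. nra.
    - apply (tends_eq _ _ (0 - 0)); [apply tends_minus; [typeclasses eauto|assumption..]|ring].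
    - apply (tends_eq _ _ (0 - 0)); [apply tends_minus; [typeclasses eauto|assumption..]|ring].
    - apply tends_const; typeclasses eauto. }
  destruct (Hall b Hb Hbr) as [[[NF _] [NH _]] _].
  replace (F b) with (/ s b) by (unfold s; field; exact NF).
  replace (s b) with (u b + (s b - u b)) by ring. rewrite E. unfold u. field. exact NH.
Qed.

(** * Reflection, translation and evenness *)

Lemma is_Cderive_reflect (f : C -> C) (z l : C) :
  is_Cderive f (- z) l -> is_Cderive (fun w => f (- w)) z (- l).
Proof.
  intros H. eapply is_Cderive_eq.
  - apply (is_Cderive_comp f (fun w => - w)); [exact H|]. apply is_Cderive_opp, is_Cderive_id.
  - ring.
Qed.

Lemma is_Cderive_shift (f : C -> C) (a z l : C) :
  is_Cderive f (z + a) l -> is_Cderive (fun w => f (w + a)) z l.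
Proof.
  intros H. eapply is_Cderive_eq.
  - apply (is_Cderive_comp f (fun w => w + a)); [exact H|].
    apply is_Cderive_plus; [apply is_Cderive_id | apply is_Cderive_const].
  - ring.
Qed.

Lemma pnbhd_is_Cderive_eq (a : C) (f g f1 g1 : C -> C) :
  pnbhd a (fun z => f z = g z) -> pnbhd a (fun z => is_Cderive f z (f1 z) /\ is_Cderive g z (g1 z)) ->
  pnbhd a (fun z => f1 z = g1 z).
Proof.
  intros H HD. destruct (filter_and (F := pnbhd a) _ _ H HD) as [r [Hr Hall]].
  exists r; split; [exact Hr|]. intros z Hz Hzr.
  destruct (Hall z Hz Hzr) as [_ [D1 D2]].
  apply (is_Cderive_unique g z); [|exact D2].
  assert (P : (0 < Cmod (z - a))%R) by (apply Cmod_gt_0, Cminus_neq_0, Hz).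
  (* The ball around [z] has to miss [a], where the functions may differ, and to stay within [r] of
     it. *)
  apply (is_Cderive_ext_near f g z (f1 z) (Rmin (Cmod (z - a)) (r - Cmod (z - a)))); [| |exact D1].
  - apply Rmin_pos; lra.
  - intros w Hw. assert (W1 := Rlt_le_trans _ _ _ Hw (Rmin_l _ _)). assert (W2 := Rlt_le_trans _ _ _ Hw (Rmin_r _ _)).
    apply Hall.
    + intros ->. replace (a - z) with (- (z - a)) in W1 by ring. rewrite Cmod_opp in W1. lra.
    + replace (w - a) with ((w - z) + (z - a)) by ring. eapply Rle_lt_trans; [apply Cmod_triangle|]. lra.
Qed.

(** The reflected function solves the same equations with the same double pole, so the two agree
    near 0. Their difference [y] satisfies [y'' = 6 (wp z + wp (- z)) y], whose coefficient is
    locally bounded off [L]; hence the agreement of values and slopes propagates. *)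
Lemma weierstrass_even (g2 g3 : C) (L : C -> Prop) (wp wp1 : C -> C) :
  is_lattice L -> (forall z, ~ L z -> weierstrass_ode_at g2 g3 wp wp1 z) ->
  tends (pnbhd 0) (fun z => z * z * wp z) 1 ->
  forall z, ~ L z -> wp (- z) = wp z /\ wp1 (- z) = - wp1 z.
Proof.
  intros HL Hode HT.
  assert (Hneg : forall z, ~ L z -> ~ L (- z)) by (intros z; rewrite lattice_opp_iff by exact HL; trivial).
  set (q := fun z => wp (- z)). set (q1 := fun z => - wp1 (- z)).
  assert (Hq : forall z, ~ L z -> weierstrass_ode_at g2 g3 q q1 z).
  { intros z Hz. destruct (Hode (- z) (Hneg z Hz)) as [D1 [D2 E]]. split; [|split].
    - apply is_Cderive_reflect. exact D1.
    - eapply is_Cderive_eq; [apply is_Cderive_opp, is_Cderive_reflect, D2|]. unfold q. ring.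
    - unfold q, q1. rewrite <- E. ring. }
  assert (Hoff := lattice_isolated L 0 HL).
  assert (Hnear : pnbhd 0 (fun z => wp z = q z)).
  { apply (pole_unique g2 g3 wp wp1 q q1).
    - revert Hoff. apply filter_imp. exact Hode.
    - exact HT.
    - revert Hoff. apply filter_imp. exact Hq.
    - intros eps Heps. generalize (pnbhd_opp _ (HT eps Heps)). apply filter_imp. intros z Hz.
      replace (z * z * q z) with (- z * - z * wp (- z)) by (unfold q; ring). exact Hz. }
  assert (Hnear1 : pnbhd 0 (fun z => wp1 z = q1 z)).
  { apply (pnbhd_is_Cderive_eq 0 wp q); [exact Hnear|]. revert Hoff. apply filter_imp.
    intros z Hz. split; [apply Hode, Hz | apply Hq, Hz]. }
  destruct (filter_ex (F := pnbhd 0) _ (filter_and (F := pnbhd 0) _ _ Hoff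
     (filter_and (F := pnbhd 0) _ _ Hnear Hnear1))) as [z0 [Hz0 [E0 E1]]].
  set (P := fun z => wp z - q z = 0 /\ wp1 z - q1 z = 0).
  assert (HP : forall z, ~ L z -> P z).
  { intros z Hz. apply (lattice_compl_propagate L P HL) with (a := z0); [|assumption..|].
    - clear z Hz. intros z Hz.
      destruct (lattice_closed L z HL Hz) as [r1 [Hr1 Hoff1]].
      destruct (Hode z Hz) as [Dw _]. destruct (Hq z Hz) as [Dq _].
      destruct (is_Cderive_locally_bounded _ _ _ (is_Cderive_plus _ _ _ _ _ Dw Dq)) as [r2 [Hr2 Hbd]].
      set (B := (Cmod (wp z + q z) + 1)%R) in *.
      assert (HB : (0 <= B)%R) by (pose proof (Cmod_ge_0 (wp z + q z)); unfold B; lra).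
      exists (Rmin r1 r2); split; [apply Rmin_pos; assumption|].
      intros v w Hv Hw [Ev Ev1].
      destruct (ball_unique (fun z => wp z - q z) (fun z => wp1 z - q1 z) (fun _ => 0)
        (fun z => wp1 z - q1 z) (fun z => 6 * (wp z + q z) * (wp z - q z)) (fun _ => 0)
        z (Rmin r1 r2) (1 + 6 * B)%R) with (v := v) (w := w) as [F1 [F2 _]]; try assumption; try reflexivity.
      + lra.
      + intros x Hx n.
        assert (X1 := Rlt_le_trans _ _ _ Hx (Rmin_l _ _)). assert (X2 := Rlt_le_trans _ _ _ Hx (Rmin_r _ _)).
        specialize (Hbd x X2). specialize (Hoff1 x X1).
        destruct (Hode x Hoff1) as [D1 [D2 _]]. destruct (Hq x Hoff1) as [G1 [G2 _]].
        pose proof (Cmod_ge_0 (wp x - q x)) as P1. pose proof (Cmod_ge_0 (wp1 x - q1 x)) as P2.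
        assert (Hn : n = (Cmod (wp x - q x) + Cmod (wp1 x - q1 x))%R) by (unfold n; rewrite Cmod_0; ring).
        rewrite Hn. split; [|split].
        * split; [apply is_Cderive_minus; assumption|]. nra.
        * split.
          -- eapply is_Cderive_eq; [apply is_Cderive_minus; eassumption|]. ring.
          -- rewrite !Cmod_mult, Cmod_R, Rabs_pos_eq by lra.
             apply (Rmult_le_compat_r (Cmod (wp x - q x))) in Hbd; [|assumption].
             assert (0 <= B * Cmod (wp1 x - q1 x))%R by (apply Rmult_le_pos; assumption). lra.
        * split; [apply is_Cderive_const|]. rewrite Cmod_0.
          apply Rmult_le_pos; lra.
      + split; assumption.
    - split; [rewrite E0 | rewrite E1]; ring. }
  intros z Hz. destruct (HP z Hz) as [A1 A2]. unfold q, q1 in A1, A2. split.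
  - replace (wp (- z)) with (wp z - (wp z - wp (- z))) by ring. rewrite A1. ring.
  - replace (wp1 (- z)) with (wp1 z - - wp1 (- z) - wp1 z) by ring. rewrite A2. ring.
Qed.

(** * The addition theorem *)

Lemma pnbhd_unshift (a : C) (P : C -> Prop) : pnbhd 0 (fun z => P (z + a)) -> pnbhd a P.
Proof.
  intros [r [Hr H]]. exists r; split; [exact Hr|]. intros z Hz Hzr.
  replace z with (z - a + a) by ring. apply H.
  - apply Cminus_neq_0, Hz.
  - replace (z - a - 0) with (z - a) by ring. exact Hzr.
Qed.

Lemma pnbhd_shift0 (a : C) (P : C -> Prop) : pnbhd a P -> pnbhd 0 (fun z => P (z + a)).
Proof. intros H. apply pnbhd_shift. rewrite Cplus_0_l. exact H. Qed.

Lemma pnbhd_neq (a : C) : pnbhd a (fun z => z <> a).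
Proof. exists 1%R. split; [lra | trivial]. Qed.

(* [Q] is the classical expression of [wp (u - rho)] given by the addition theorem. *)
Lemma addition_quotient_ode (g2 g3 rho : C) (wp wp1 : C -> C) (u : C) :
  wp1 rho * wp1 rho = 4 * (wp rho * wp rho * wp rho) - g2 * wp rho - g3 ->
  weierstrass_ode_at g2 g3 wp wp1 u -> wp u <> wp rho ->
  let Rq := fun u => (wp1 u + wp1 rho) * / (2 * (wp u - wp rho)) in
  let Q := fun u => Rq u * Rq u - wp u - wp rho in
  is_Cderive Rq u (wp u - Q u) /\
  weierstrass_ode_at g2 g3 Q (fun u => 2 * (Rq u * (wp u - Q u)) - wp1 u) u.
Proof.
  intros Hrho [D1 [D2 Hu]] Hne Rq Q.
  pose proof (Cminus_neq_0 _ _ Hne) as HD.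
  (* The cubic relations at [u] and at [rho] are solved for [g2] and [g3]. After this elimination
     every claim is a rational identity in the values of [wp] and [wp1] at the two points. *)
  assert (Hg2 : g2 = 4 * (wp u * wp u + wp u * wp rho + wp rho * wp rho)
                 - (wp1 u * wp1 u - wp1 rho * wp1 rho) / (wp u - wp rho)).
  { rewrite Hrho, Hu. field. exact HD. }
  assert (Hg3 : g3 = 4 * (wp u * wp u * wp u) - g2 * wp u - wp1 u * wp1 u) by (rewrite Hu; ring).
  assert (DR : is_Cderive Rq u (wp u - Q u)).
  { eapply is_Cderive_eq.
    - unfold Rq. cderive. apply Cmult_neq_0; [|exact HD]. intros E. apply RtoC_inj in E. lra.
    - unfold Q, Rq. rewrite Hg2. field. exact HD. }
  assert (DQ : is_Cderive Q u (2 * (Rq u * (wp u - Q u)) - wp1 u)).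
  { eapply is_Cderive_eq; [unfold Q at 1; cderive|]. ring. }
  split; [exact DR|]. split; [exact DQ|]. split.
  - eapply is_Cderive_eq; [cderive|]. unfold Q, Rq. rewrite Hg2. field. exact HD.
  - unfold Q, Rq. rewrite Hg3, Hg2. field. exact HD.
Qed.

Section Addition.
Context (g2 g3 : C) (L : C -> Prop) (wp wp1 zeta : C -> C) (rho : C).
Context (HL : is_lattice L).
Context (Hode : forall z, ~ L z -> weierstrass_ode_at g2 g3 wp wp1 z).
Context (Hper : forall z w, ~ L z -> L w -> wp (z + w) = wp z).
Context (Hpole : tends (pnbhd 0) (fun z => z * z * wp z) 1).
Context (Hzeta : forall z, ~ L z -> is_Cderive zeta z (- wp z)).
Context (Hzpole : tends (pnbhd 0) (fun z => zeta z - / z) 0).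
Context (Hrho : ~ L rho) (Hp : wp1 rho <> 0).

(** Half the slope of the chord joining the points with parameters [u] and [- rho] on the curve
    [Y^2 = 4 X^3 - g2 X - g3]. The abscissas of the three points on a line of slope [m] sum to
    [m^2 / 4], which explains [Q]. *)
Let Rq (u : C) : C := (wp1 u + wp1 rho) * / (2 * (wp u - wp rho)).
Let Q (u : C) : C := Rq u * Rq u - wp u - wp rho.
Let G (u : C) : C := zeta (u - rho) - zeta u + zeta rho.

Let slope_wp : tends (pnbhd rho) (fun w => (wp w - wp rho) / (w - rho)) (wp1 rho).
Proof. apply is_Cderive_slope. exact (proj1 (Hode rho Hrho)). Qed.

Let wp_neq : pnbhd rho (fun w => wp w <> wp rho).
Proof.
  generalize (tends_neq (pnbhd rho) _ _ 0 slope_wp Hp). apply filter_imp.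
  intros w Hw E. apply Hw. rewrite E. unfold Cdiv, Cminus. rewrite Cplus_opp_r. apply Cmult_0_l.
Qed.

Let wp1_tends : tends (pnbhd rho) wp1 (wp1 rho).
Proof. exact (tends_derivable _ _ _ (proj1 (proj2 (Hode rho Hrho)))). Qed.

Let wp_tends : tends (pnbhd rho) wp (wp rho).
Proof. exact (tends_derivable _ _ _ (proj1 (Hode rho Hrho))). Qed.

Let two_neq : RtoC 2 <> 0.
Proof. intros E. apply RtoC_inj in E. lra. Qed.

(** As [wp1 rho] is nonzero, [wp w - wp rho] has a simple zero at [rho] and [(w - rho) * Rq w] tends
    to [2 wp1 rho / (2 wp1 rho) = 1]. *)
Lemma addition_quotient_pole : tends (pnbhd rho) (fun w => (w - rho) * (w - rho) * Q w) 1.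
Proof.
  apply tends_ext with (f := fun w =>
    ((wp1 w + wp1 rho) * / (2 * ((wp w - wp rho) / (w - rho)))) *
    ((wp1 w + wp1 rho) * / (2 * ((wp w - wp rho) / (w - rho)))) -
    (w - rho) * (w - rho) * (wp w + wp rho)); [typeclasses eauto| |].
  - generalize (filter_and (F := pnbhd rho) _ _ wp_neq (pnbhd_neq rho)).
    apply filter_imp. intros w [H1 H2]. unfold Q, Rq. field.
    split; apply Cminus_neq_0; assumption.
  - apply (tends_eq _ _ (((wp1 rho + wp1 rho) * / (2 * wp1 rho)) * ((wp1 rho + wp1 rho) * / (2 * wp1 rho))
       - (rho - rho) * (rho - rho) * (wp rho + wp rho))); [|field; exact Hp].
    repeat first [exact slope_wp | exact wp1_tends | exact wp_tends | apply tends_const; typeclasses eauto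
      | apply tends_id | apply tends_inv; [typeclasses eauto| | apply Cmult_neq_0; [exact two_neq | exact Hp]]
      | apply tends_minus; [typeclasses eauto| |] | apply tends_mult; [typeclasses eauto| |]
      | apply tends_plus; [typeclasses eauto| |]].
Qed.

Lemma addition_quotient_near : pnbhd rho (fun w => Q w = wp (w - rho)).
Proof.
  assert (Hoff := lattice_isolated L rho HL).
  apply pnbhd_unshift.
  assert (H : pnbhd 0 (fun z => Q (z + rho) = wp z)).
  { apply (pole_unique g2 g3 (fun z => Q (z + rho))
      (fun z => 2 * (Rq (z + rho) * (wp (z + rho) - Q (z + rho))) - wp1 (z + rho)) wp wp1).
    - generalize (pnbhd_shift0 _ _ (filter_and (F := pnbhd rho) _ _ Hoff wp_neq)).
      apply filter_imp. intros z [H1 H2].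
      destruct (addition_quotient_ode g2 g3 rho wp wp1 (z + rho)) as [_ [D1 [D2 E]]].
      + apply Hode, Hrho.
      + apply Hode, H1.
      + exact H2.
      + split; [|split].
        * apply (is_Cderive_shift Q). exact D1.
        * apply (is_Cderive_shift (fun u => 2 * (Rq u * (wp u - Q u)) - wp1 u)). exact D2.
        * exact E.
    - intros eps Heps. generalize (pnbhd_shift0 _ _ (addition_quotient_pole eps Heps)).
      apply filter_imp. intros z Hz. replace (z + rho - rho) with z in Hz by ring. exact Hz.
    - generalize (lattice_isolated L 0 HL). apply filter_imp. exact Hode.
    - exact Hpole. }
  revert H. apply filter_imp. intros z Hz. rewrite Hz. f_equal. ring.
Qed.

(* The numerator of [Rq w - 1/(w - rho)] is [o((w - rho)^2)], by the mean value inequality applied to its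
   derivative, which is [o(w - rho)]. *)
Lemma addition_quotient_expansion : tends (pnbhd rho) (fun w => Rq w - / (w - rho)) 0.
Proof.
  destruct (Hode rho Hrho) as [D1 [D2 _]].
  set (wp2 := fun z => 6 * (wp z * wp z) - g2 / 2) in *.
  set (n := fun w => (w - rho) * (wp1 w + wp1 rho) - 2 * (wp w - wp rho)).
  set (n1 := fun w => wp1 rho - wp1 w + (w - rho) * wp2 w).
  assert (Dn : forall w, ~ L w -> is_Cderive n w (n1 w)).
  { intros w Hw. destruct (Hode w Hw) as [E1 [E2 _]]. fold (wp2 w) in E2.
    eapply is_Cderive_eq; [unfold n; cderive|]. unfold n1. ring. }
  (* This function is [n1 w / (w - rho)]; both of its terms tend to [wp2 rho], the derivative of
     [wp1] at [rho]. *)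
  assert (T1 : tends (pnbhd rho) (fun w => wp2 w - (wp1 w - wp1 rho) / (w - rho)) 0).
  { apply (tends_eq _ _ (wp2 rho - wp2 rho)); [|ring].
    apply tends_minus; [typeclasses eauto| |].
    - unfold wp2. repeat first [exact wp_tends | apply tends_const; typeclasses eauto
        | apply tends_minus; [typeclasses eauto| |] | apply tends_mult; [typeclasses eauto| |]].
    - apply is_Cderive_slope. exact D2. }
  assert (T2 : tends (pnbhd rho) (fun w => n w / ((w - rho) * (w - rho))) 0).
  { intros eps Heps.
    destruct (filter_and (F := pnbhd rho) _ _ (T1 (eps / 4)%R ltac:(lra)) (lattice_isolated L rho HL))
      as [r [Hr H]].
    exists r; split; [exact Hr|]. intros w Hw Hwr.
    assert (W0 := Cminus_neq_0 _ _ Hw). assert (W1 := proj1 (Cmod_gt_0 _) W0).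
    assert (B : (Cmod (n w - n rho) <= 2 * (eps / 4 * Cmod (w - rho)) * Cmod (w - rho))%R).
    { apply (segment_mean_value n n1). intros t Ht. set (x := rho + t * (w - rho)).
      assert (Ex : x - rho = t * (w - rho)) by (unfold x; ring).
      assert (Hx : (Cmod (x - rho) <= Cmod (w - rho))%R).
      { rewrite Ex, Cmod_mult, Cmod_R, Rabs_pos_eq by lra. pose proof (Cmod_ge_0 (w - rho)). nra. }
      destruct (classic (x = rho)) as [E|Hne].
      - rewrite E. split; [apply Dn, Hrho|]. unfold n1.
        replace (wp1 rho - wp1 rho + (rho - rho) * wp2 rho) with (RtoC 0) by ring.
        rewrite Cmod_0. apply Rmult_le_pos; lra.
      - destruct (H x Hne ltac:(lra)) as [H1 H2]. split; [apply Dn, H2|].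
        pose proof (Cminus_neq_0 _ _ Hne) as X0.
        replace (n1 x) with ((wp2 x - (wp1 x - wp1 rho) / (x - rho) - 0) * (x - rho))
          by (unfold n1; field; exact X0).
        rewrite Cmod_mult. apply Rmult_le_compat; [apply Cmod_ge_0..| |exact Hx]. lra. }
    replace (n rho) with (RtoC 0) in B by (unfold n; ring).
    replace (n w - 0) with (n w) in B by ring.
    replace (n w / ((w - rho) * (w - rho)) - 0) with (n w / ((w - rho) * (w - rho))) by (field; exact W0).
    rewrite Cmod_div, Cmod_mult by (apply Cmult_neq_0; exact W0).
    apply Rlt_div_l; [apply Rmult_lt_0_compat; exact W1|].
    assert (0 < Cmod (w - rho) * Cmod (w - rho))%R by (apply Rmult_lt_0_compat; exact W1). nra. }
  apply tends_ext with (f := fun w =>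
    n w / ((w - rho) * (w - rho)) * / (2 * ((wp w - wp rho) / (w - rho)))); [typeclasses eauto| |].
  - generalize (filter_and (F := pnbhd rho) _ _ wp_neq (pnbhd_neq rho)).
    apply filter_imp. intros w [H1 H2]. unfold n, Rq. field.
    split; apply Cminus_neq_0; assumption.
  - apply (tends_eq _ _ (0 * / (2 * wp1 rho))); [|ring].
    apply tends_mult; [typeclasses eauto|exact T2|].
    apply tends_inv; [typeclasses eauto| |apply Cmult_neq_0; [exact two_neq | exact Hp]].
    apply tends_mult; [typeclasses eauto|apply tends_const; typeclasses eauto|exact slope_wp].
Qed.

Let dG (u : C) : ~ L u -> ~ L (u - rho) -> is_Cderive G u (wp u - wp (u - rho)).
Proof.
  intros H1 H2. eapply is_Cderive_eq.
  - apply is_Cderive_plus; [apply is_Cderive_minus; [apply is_Cderive_shift|]; apply Hzeta; assumption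
      | apply is_Cderive_const].
  - unfold Cminus. ring.
Qed.

(** The term [zeta rho] in [G] cancels the limit of [- zeta w]. A constant added to [zeta] would be
    added to [G] too, so the normalisation of [zeta] at 0 matters here. *)
Lemma zeta_difference_expansion : tends (pnbhd rho) (fun w => G w - / (w - rho)) 0.
Proof.
  apply tends_ext with (f := fun w => (zeta (w - rho) - / (w - rho)) - zeta w + zeta rho);
    [typeclasses eauto|apply filter_forall; intros w; unfold G; ring|].
  apply (tends_eq _ _ (0 - zeta rho + zeta rho)); [|ring].
  apply tends_plus; [typeclasses eauto| |apply tends_const; typeclasses eauto].
  apply tends_minus; [typeclasses eauto| |eapply tends_derivable; apply Hzeta, Hrho].
  intros eps Heps. apply pnbhd_unshift. generalize (Hzpole eps Heps). apply filter_imp.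
  intros z Hz. replace (z + rho - rho) with z by ring. exact Hz.
Qed.

(** Near [rho] both [Rq] and [G] have derivative [wp u - wp (u - rho)], and their difference tends
    to 0 at [rho]. Hence they coincide, and the definition of [Q] becomes the claim. *)
Lemma addition_near : pnbhd rho (fun u => G u * G u - wp u - wp (u - rho) - wp rho = 0).
Proof.
  assert (T : tends (pnbhd rho) (fun w => Rq w - G w) 0).
  { apply tends_ext with (f := fun w => (Rq w - / (w - rho)) - (G w - / (w - rho)));
      [typeclasses eauto|apply filter_forall; intros w; ring|].
    apply (tends_eq _ _ (0 - 0)); [|ring].
    apply tends_minus; [typeclasses eauto|exact addition_quotient_expansion|exact zeta_difference_expansion]. }
  assert (Hoff : pnbhd rho (fun u => ~ L (u - rho))).
  { apply pnbhd_unshift. generalize (lattice_isolated L 0 HL). apply filter_imp.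
    intros z Hz. replace (z + rho - rho) with z by ring. exact Hz. }
  destruct (filter_and (F := pnbhd rho) _ _
    (filter_and (F := pnbhd rho) _ _ addition_quotient_near wp_neq)
    (filter_and (F := pnbhd rho) _ _ (lattice_isolated L rho HL) Hoff)) as [r [Hr H]].
  exists r; split; [exact Hr|]. intros b Hb Hbr.
  assert (E : Rq b - G b = 0).
  { apply (ray_unique (fun w => Rq w - G w) (fun _ => 0) (fun _ => 0) (fun _ => 0) (fun _ => 0) (fun _ => 0)
      rho b 0); [lra| |exact Hb|exact T|apply tends_const; typeclasses eauto..].
    intros t Ht z n.
    assert (Ez : z - rho = t * (b - rho)) by (unfold z; ring).
    assert (Hz0 : z <> rho).
    { intros E. rewrite E in Ez. assert (N : t * (b - rho) <> 0).
      { apply Cmult_neq_0; [intros E'; apply RtoC_inj in E'; lra | apply Cminus_neq_0, Hb]. }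
      apply N. rewrite <- Ez. ring. }
    assert (Hzr : (Cmod (z - rho) < r)%R).
    { rewrite Ez, Cmod_mult, Cmod_R, Rabs_pos_eq by lra. pose proof (Cmod_ge_0 (b - rho)). nra. }
    destruct (H z Hz0 Hzr) as [[E1 E2] [H1 H2]].
    rewrite Cmod_0, Rmult_0_l. split; [|split; split; [apply is_Cderive_const|lra|apply is_Cderive_const|lra]].
    split; [|lra].
    destruct (addition_quotient_ode g2 g3 rho wp wp1 z) as [DR _];
      [apply Hode, Hrho | apply Hode, H1 | exact E2 |].
    eapply is_Cderive_eq; [apply is_Cderive_minus; [exact DR | apply dG; assumption]|].
    rewrite <- E1. unfold Q, Rq. ring. }
  destruct (H b Hb Hbr) as [[E1 _] _]. rewrite <- E1.
  replace (G b) with (Rq b - (Rq b - G b)) by ring. rewrite E. unfold Q. ring.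
Qed.

(** The increment of [zeta] along a period is a constant, by periodicity of its derivative, and
    occurs in [G] with both signs. *)
Lemma zeta_difference_periodic (u w : C) :
  ~ L u -> ~ L (u - rho) -> L w -> G (u + w) = G u.
Proof.
  intros H1 H2 Hw.
  assert (E : zeta (u - rho + w) - zeta (u - rho) = zeta (u + w) - zeta u).
  { apply (lattice_compl_const L (fun z => zeta (z + w) - zeta z) HL); [|assumption..].
    intros z Hz. eapply is_Cderive_eq.
    - apply is_Cderive_minus; [apply is_Cderive_shift|]; apply Hzeta; [|exact Hz].
      rewrite lattice_shift by assumption. exact Hz.
    - rewrite Hper by assumption. ring. }
  unfold G. replace (u + w - rho) with (u - rho + w) by ring.
  replace (zeta (u - rho + w)) with (zeta (u - rho + w) - zeta (u - rho) + zeta (u - rho)) by ring.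
  rewrite E. ring.
Qed.

(* [K' = M], [M' = N] and [N' = 6 (wp u + wp (u - rho)) M], so that the vanishing of [K] propagates from
   a neighbourhood of [rho] to the whole domain; [K] is periodic, which handles the other points of
   [rho + L]. *)
Lemma zeta_addition (u : C) :
  ~ L u -> ~ L (u - rho) -> G u * G u = wp u + wp (u - rho) + wp rho.
Proof.
  set (K := fun u => G u * G u - wp u - wp (u - rho) - wp rho).
  set (M := fun u => 2 * (G u * (wp u - wp (u - rho))) - wp1 u - wp1 (u - rho)).
  set (N := fun u => 2 * (G u * (wp1 u - wp1 (u - rho)))
    - 4 * (wp u * wp u + wp u * wp (u - rho) + wp (u - rho) * wp (u - rho)) + g2).
  assert (dB : forall u, ~ L (u - rho) -> is_Cderive (fun u => wp (u - rho)) u (wp1 (u - rho))).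
  { intros v Hv. apply (is_Cderive_shift wp). exact (proj1 (Hode _ Hv)). }
  assert (dB1 : forall u, ~ L (u - rho) ->
     is_Cderive (fun u => wp1 (u - rho)) u (6 * (wp (u - rho) * wp (u - rho)) - g2 / 2)).
  { intros v Hv. apply (is_Cderive_shift wp1). exact (proj1 (proj2 (Hode _ Hv))). }
  assert (dK : forall u, ~ L u -> ~ L (u - rho) -> is_Cderive K u (M u)).
  { intros v H1 H2. destruct (Hode v H1) as [D1 [D2 _]]. pose proof (dG v H1 H2) as DG.
    pose proof (dB v H2) as DB. eapply is_Cderive_eq.
    - apply is_Cderive_minus; [apply is_Cderive_minus; [apply is_Cderive_minus; [apply is_Cderive_mult|]|]
        |apply is_Cderive_const]; eassumption.
    - unfold M. ring. }
  assert (dM : forall u, ~ L u -> ~ L (u - rho) -> is_Cderive M u (N u)).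
  { intros v H1 H2. destruct (Hode v H1) as [D1 [D2 _]]. pose proof (dG v H1 H2) as DG.
    pose proof (dB v H2) as DB. pose proof (dB1 v H2) as DB1. eapply is_Cderive_eq.
    - apply is_Cderive_minus; [apply is_Cderive_minus; [apply is_Cderive_mult; [apply is_Cderive_const
        |apply is_Cderive_mult; [|apply is_Cderive_minus]]|]|]; eassumption.
    - unfold N. field. }
  assert (dN : forall u, ~ L u -> ~ L (u - rho) -> is_Cderive N u (6 * (wp u + wp (u - rho)) * M u)).
  { intros v H1 H2. destruct (Hode v H1) as [D1 [D2 _]]. pose proof (dG v H1 H2) as DG.
    pose proof (dB v H2) as DB. pose proof (dB1 v H2) as DB1. eapply is_Cderive_eq.
    - apply is_Cderive_plus; [apply is_Cderive_minus; [apply is_Cderive_mult; [apply is_Cderive_const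
        |apply is_Cderive_mult; [|apply is_Cderive_minus]]|apply is_Cderive_mult; [apply is_Cderive_const
        |apply is_Cderive_plus; [apply is_Cderive_plus|]; apply is_Cderive_mult]]|apply is_Cderive_const];
        eassumption.
    - unfold M. field. }
  (* Stated as vanishing near [u] wherever [K] is regular, [P] makes sense at points of [rho + L] as
     well, so paths have to avoid [L] only. *)
  set (P := fun u => exists r, (0 < r)%R /\
     forall v, (Cmod (v - u) < r)%R -> ~ L v -> ~ L (v - rho) -> K v = 0).
  assert (Htri : forall a b c : C, (Cmod (a - c) <= Cmod (a - b) + Cmod (b - c))%R).
  { intros a b c. replace (a - c) with ((a - b) + (b - c)) by ring. apply Cmod_triangle. }
  assert (HPrho : P rho).
  { destruct addition_near as [r [Hr H]]. exists r; split; [exact Hr|]. intros v Hv H1 H2.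
    apply H; [|exact Hv]. intros ->. apply H2. replace (rho - rho) with (RtoC 0) by ring. apply lattice_zero, HL. }
  assert (HPper : forall u, L (u - rho) -> P u).
  { intros v Hv. destruct HPrho as [r [Hr H]]. exists r; split; [exact Hr|]. intros x Hx H1 H2.
    set (w := v - rho) in *.
    assert (Hw : L (- w)) by (apply lattice_opp; assumption).
    assert (Y1 : ~ L (x + - w)) by (rewrite lattice_shift by assumption; exact H1).
    assert (Y2 : ~ L (x + - w - rho)).
    { replace (x + - w - rho) with (x - rho + - w) by ring. rewrite lattice_shift by assumption. exact H2. }
    rewrite <- (H (x + - w)); [|replace (x + - w - rho) with (x - v) by (unfold w; ring); exact Hx|exact Y1|exact Y2].
    unfold K. rewrite zeta_difference_periodic by assumption.
    replace (x + - w - rho) with (x - rho + - w) by ring. rewrite !Hper by assumption. reflexivity. }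
  intros Hu Hu'.
  assert (HPu : P u).
  { apply (lattice_compl_propagate L P HL) with (a := rho); [|assumption..].
    clear u Hu Hu'. intros u Hu.
    destruct (classic (L (u - rho))) as [Hu'|Hu'].
    - destruct (HPper u Hu') as [r [Hr H]]. exists (r / 2)%R; split; [lra|].
      intros _ w _ Hw _. exists (r / 2)%R; split; [lra|]. intros v Hv. apply H.
      pose proof (Htri v w u). lra.
    - destruct (lattice_closed L u HL Hu) as [r1 [Hr1 O1]].
      destruct (lattice_closed L (u - rho) HL Hu') as [r2 [Hr2 O2]].
      assert (O2' : forall v, (Cmod (v - u) < r2)%R -> ~ L (v - rho)).
      { intros v Hv. apply O2. replace (v - rho - (u - rho)) with (v - u) by ring. exact Hv. }
      destruct (is_Cderive_locally_bounded _ _ _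
        (is_Cderive_plus _ _ _ _ _ (proj1 (Hode u Hu)) (dB u Hu'))) as [r3 [Hr3 Hbd]].
      set (B := (Cmod (wp u + wp (u - rho)) + 1)%R) in *.
      assert (HB : (0 <= B)%R) by (pose proof (Cmod_ge_0 (wp u + wp (u - rho))); unfold B; lra).
      set (r := Rmin r1 (Rmin r2 r3)).
      assert (Hr : (0 < r)%R) by (repeat apply Rmin_pos; assumption).
      assert (R1 : (r <= r1)%R) by apply Rmin_l.
      assert (R2 : (r <= r2)%R) by (eapply Rle_trans; [apply Rmin_r | apply Rmin_l]).
      assert (R3 : (r <= r3)%R) by (eapply Rle_trans; [apply Rmin_r | apply Rmin_r]).
      exists r; split; [exact Hr|]. intros v w Hv Hw [rv [Hrv HK]].
      set (s := Rmin rv (r - Cmod (v - u))%R).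
      assert (Hs : (0 < s)%R) by (apply Rmin_pos; lra).
      assert (S1 : (s <= rv)%R) by apply Rmin_l. assert (S2 : (s <= r - Cmod (v - u))%R) by apply Rmin_r.
      assert (In : forall x, (Cmod (x - v) < s)%R -> ~ L x /\ ~ L (x - rho)).
      { intros x Hx. pose proof (Htri x v u). split; [apply O1 | apply O2']; lra. }
      assert (K0 : forall x, (Cmod (x - v) < s)%R -> K x = 0).
      { intros x Hx. destruct (In x Hx). apply HK; [lra|assumption..]. }
      (* The vanishing of [K] on a whole ball around [v] passes to its derivatives [M] and [N],
         which supplies the zero initial values of the system at [v]. *)
      assert (Hzero : forall f f1 : C -> C,
        (forall x, ~ L x -> ~ L (x - rho) -> is_Cderive f x (f1 x)) ->
        (forall x, (Cmod (x - v) < s)%R -> f x = 0) -> forall x, (Cmod (x - v) < s)%R -> f1 x = 0).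
      { intros f f1 Hf Hf0 x Hx. destruct (In x Hx). apply (is_Cderive_zero_near f x); [|auto].
        exists (s - Cmod (x - v))%R. split; [lra|]. intros y Hy. apply Hf0. pose proof (Htri y x v). lra. }
      pose proof (Hzero K M dK K0) as M0. pose proof (Hzero M N dM M0) as N0.
      assert (Hvs : (Cmod (v - v) < s)%R) by (replace (v - v) with (RtoC 0) by ring; rewrite Cmod_0; exact Hs).
      assert (HKall : forall x, (Cmod (x - u) < r)%R -> K x = 0).
      { intros x Hx.
        apply (ball_unique K M N M N (fun u => 6 * (wp u + wp (u - rho)) * M u) u r (1 + 6 * B)%R)
          with (v := v); auto; [lra|].
        intros y Hy n. assert (Y1 : ~ L y) by (apply O1; lra). assert (Y2 : ~ L (y - rho)) by (apply O2'; lra).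
        specialize (Hbd y ltac:(lra)).
        pose proof (Cmod_ge_0 (K y)) as PK. pose proof (Cmod_ge_0 (M y)) as PM. pose proof (Cmod_ge_0 (N y)) as PN.
        assert (BK : (0 <= B * Cmod (K y))%R) by (apply Rmult_le_pos; assumption).
        assert (BM : (0 <= B * Cmod (M y))%R) by (apply Rmult_le_pos; assumption).
        assert (BN : (0 <= B * Cmod (N y))%R) by (apply Rmult_le_pos; assumption).
        unfold n. split; [|split].
        - split; [apply dK; assumption|]. lra.
        - split; [apply dM; assumption|]. lra.
        - split; [apply dN; assumption|]. rewrite !Cmod_mult, Cmod_R, Rabs_pos_eq by lra.
          apply (Rmult_le_compat_r (Cmod (M y))) in Hbd; [|assumption]. lra. }
      exists (r - Cmod (w - u))%R. split; [lra|]. intros x Hx _ _. apply HKall.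
      pose proof (Htri x w u). lra. }
  destruct HPu as [r [Hr H]].
  assert (E : K u = 0).
  { apply H; [|assumption..]. replace (u - u) with (RtoC 0) by ring. rewrite Cmod_0. exact Hr. }
  replace (G u * G u) with (K u + (wp u + wp (u - rho) + wp rho)) by (unfold K; ring).
  rewrite E. ring.
Qed.

End Addition.

(** * The exponential and square roots *)

Lemma derivable_pt_lim_zero_bound (f : R -> R) (l : R) :
  derivable_pt_lim f 0 l -> forall eps, (0 < eps)%R -> exists del, (0 < del)%R /\
    forall h, (Rabs h < del)%R -> (Rabs (f h - f 0%R - l * h) <= eps * Rabs h)%R.
Proof.
  intros H eps Heps. destruct (H eps Heps) as [del Hd].
  exists del; split; [apply cond_pos|]. intros h Hh.
  destruct (Req_dec h 0) as [->|Hn].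
  - replace (f 0 - f 0 - l * 0)%R with 0%R by ring. rewrite Rabs_R0. lra.
  - specialize (Hd h Hn Hh). rewrite Rplus_0_l in Hd.
    replace (f h - f 0 - l * h)%R with (((f h - f 0) / h - l) * h)%R by (field; exact Hn).
    rewrite Rabs_mult. apply Rmult_le_compat_r; [apply Rabs_pos | lra].
Qed.

Lemma Cexp_plus (z w : C) : Cexp (z + w) = Cexp z * Cexp w.
Proof.
  destruct z as [a b], w as [c d]. unfold Cexp, Cplus, Cmult, Re, Im; simpl.
  rewrite exp_plus, cos_plus, sin_plus. apply injective_projections; simpl; ring.
Qed.

Lemma Cexp_neq_0 (z : C) : Cexp z <> 0.
Proof.
  intros E. assert (H : Cexp z * Cexp (- z) = 1).
  { rewrite <- Cexp_plus, Cplus_opp_r. unfold Cexp; simpl. rewrite exp_0, cos_0, sin_0.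
    apply injective_projections; simpl; ring. }
  rewrite E, Cmult_0_l in H. apply C1_nz. symmetry. exact H.
Qed.

(** The functional equation reduces the claim to [Cexp h - 1 - h = o(h)], which follows from the
    real derivatives of [exp], [cos] and [sin] at 0. *)
Lemma is_Cderive_Cexp (z : C) : is_Cderive Cexp z (Cexp z).
Proof.
  apply is_Cderive_eps. intros eps Heps.
  (* The 9 is the sum of the bounds [4 e m] and [5 e m] found below for the real and the imaginary
     part of [Cexp h - 1 - h], where [m = Cmod h]. *)
  set (B := (9 * (Cmod (Cexp z) + 1))%R).
  pose proof (Cmod_ge_0 (Cexp z)) as PE.
  assert (HB : (0 < B)%R) by (unfold B; lra).
  set (e := Rmin 1 (eps / B)).
  assert (He : (0 < e)%R) by (apply Rmin_pos; [lra | apply Rdiv_lt_0_compat; lra]).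
  assert (He1 : (e <= 1)%R) by apply Rmin_l.
  assert (He2 : (e <= eps / B)%R) by apply Rmin_r.
  clearbody e.
  destruct (derivable_pt_lim_zero_bound _ _ (derivable_pt_lim_exp 0) e He) as [d1 [Hd1 H1]].
  destruct (derivable_pt_lim_zero_bound _ _ (derivable_pt_lim_cos 0) e He) as [d2 [Hd2 H2]].
  destruct (derivable_pt_lim_zero_bound _ _ (derivable_pt_lim_sin 0) e He) as [d3 [Hd3 H3]].
  rewrite exp_0 in H1. rewrite sin_0, cos_0 in H2. rewrite sin_0, cos_0 in H3.
  exists (Rmin e (Rmin d1 (Rmin d2 d3))). split; [repeat apply Rmin_pos; assumption|].
  intros w Hw. set (h := w - z) in *.
  replace (Cexp w - Cexp z - h * Cexp z) with (Cexp z * (Cexp h - 1 - h)).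
  2: { replace w with (z + h) by (unfold h; ring). rewrite Cexp_plus. ring. }
  assert (W0 : (Cmod h < e)%R) by (eapply Rlt_le_trans; [exact Hw | apply Rmin_l]).
  assert (W' : (Cmod h < Rmin d1 (Rmin d2 d3))%R) by (eapply Rlt_le_trans; [exact Hw | apply Rmin_r]).
  assert (W1 : (Cmod h < d1)%R) by (eapply Rlt_le_trans; [exact W' | apply Rmin_l]).
  assert (W'' : (Cmod h < Rmin d2 d3)%R) by (eapply Rlt_le_trans; [exact W' | apply Rmin_r]).
  assert (W2 : (Cmod h < d2)%R) by (eapply Rlt_le_trans; [exact W'' | apply Rmin_l]).
  assert (W3 : (Cmod h < d3)%R) by (eapply Rlt_le_trans; [exact W'' | apply Rmin_r]).
  clearbody h. clear Hw W' W''.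
  set (s := Re h). set (t := Im h).
  assert (Hs : (Rabs s <= Cmod h)%R) by apply re_le_Cmod.
  assert (Ht : (Rabs t <= Cmod h)%R) by apply im_le_Cmod.
  specialize (H1 s ltac:(lra)). specialize (H2 t ltac:(lra)). specialize (H3 t ltac:(lra)).
  set (m := Cmod h) in *. assert (Pm : (0 <= m)%R) by apply Cmod_ge_0.
  assert (Em : (0 <= e * m)%R) by (apply Rmult_le_pos; lra).
  assert (X : forall y, (Rabs y <= m)%R -> (e * Rabs y <= e * m)%R) by (intros; apply Rmult_le_compat_l; lra).
  pose proof (X s Hs) as Xs. pose proof (X t Ht) as Xt.
  set (u := (exp s - 1 - 1 * s)%R) in *. set (c := (cos t - 1 - -0 * t)%R) in *. set (q := (sin t - 0 - 1 * t)%R) in *.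
  assert (Hu : (Rabs (exp s - 1) <= 2 * m)%R).
  { replace (exp s - 1)%R with (u + s)%R by (unfold u; ring). eapply Rle_trans; [apply Rabs_triang|]. nra. }
  assert (Hex : (Rabs (exp s) <= 3)%R).
  { replace (exp s) with ((exp s - 1) + 1)%R by ring. eapply Rle_trans; [apply Rabs_triang|].
    rewrite Rabs_R1. lra. }
  assert (A1 : (Rabs (Re (Cexp h - 1 - h)) <= 4 * (e * m))%R).
  { replace (Re (Cexp h - 1 - h)) with (u + exp s * c)%R
      by (unfold u, c, s, t, Cexp, Re, Im; simpl; ring).
    eapply Rle_trans; [apply Rabs_triang|]. rewrite Rabs_mult.
    assert (Rabs (exp s) * Rabs c <= 3 * (e * m))%R; [|lra].
    apply Rmult_le_compat; [apply Rabs_pos..|exact Hex|lra]. }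
  assert (A2 : (Rabs (Im (Cexp h - 1 - h)) <= 5 * (e * m))%R).
  { replace (Im (Cexp h - 1 - h)) with (exp s * q + (exp s - 1) * t)%R
      by (unfold q, s, t, Cexp, Re, Im; simpl; ring).
    eapply Rle_trans; [apply Rabs_triang|]. rewrite !Rabs_mult.
    assert (Rabs (exp s) * Rabs q <= 3 * (e * m))%R.
    { apply Rmult_le_compat; [apply Rabs_pos..|exact Hex|lra]. }
    assert (Rabs (exp s - 1) * Rabs t <= 2 * m * e)%R; [|lra].
    apply Rmult_le_compat; [apply Rabs_pos..|exact Hu|lra]. }
  rewrite Cmod_mult. pose proof (Cmod_le_Re_Im (Cexp h - 1 - h)) as A3.
  assert (A4 : (Cmod (Cexp h - 1 - h) <= 9 * (e * m))%R) by lra.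
  apply (Rmult_le_compat_l _ _ _ PE) in A4.
  assert (A5 : (B * (e * m) <= eps * m)%R).
  { replace (B * (e * m))%R with (B * e * m)%R by ring. apply Rmult_le_compat_r; [exact Pm|].
    apply (Rmult_le_compat_l B) in He2; [|lra]. replace (B * (eps / B))%R with eps in He2 by (field; lra). exact He2. }
  unfold B in A5. nra.
Qed.

Lemma is_Cderive_Cexp_scal (a z : C) : is_Cderive (fun w => Cexp (a * w)) z (a * Cexp (a * z)).
Proof.
  eapply is_Cderive_eq.
  - apply (is_Cderive_comp Cexp (fun w => a * w)); [apply is_Cderive_Cexp|].
    apply is_Cderive_mult; [apply is_Cderive_const | apply is_Cderive_id].
  - cbv beta. ring.
Qed.

(** Half-angle formulas; the sign of the imaginary part of the root is chosen so that twice the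
    product of its parts is [Im w]. *)
Lemma complex_square_root (w : C) : exists k : C, k * k = w.
Proof.
  pose proof (Cmod_ge_0 w) as Pw. pose proof (re_le_Cmod w) as Hre. pose proof (Cmod2_alt w) as H2.
  set (r := Cmod w) in *. set (a := Re w) in *. set (b := Im w) in *.
  apply Rabs_le_between in Hre.
  set (x := sqrt ((r + a) / 2)). set (y := sqrt ((r - a) / 2)).
  assert (Hx : (x * x = (r + a) / 2)%R) by (apply sqrt_sqrt; lra).
  assert (Hy : (y * y = (r - a) / 2)%R) by (apply sqrt_sqrt; lra).
  assert (Hxy : (2 * (x * y) = Rabs b)%R).
  { assert (Px : (0 <= x)%R) by apply sqrt_pos. assert (Py : (0 <= y)%R) by apply sqrt_pos.
    rewrite <- (Rabs_pos_eq (2 * (x * y))) by nra. apply Rsqr_eq_abs_0. unfold Rsqr.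
    replace (2 * (x * y) * (2 * (x * y)))%R with (4 * (x * x) * (y * y))%R by ring. rewrite Hx, Hy. nra. }
  assert (Ew : w = (a, b)) by (apply surjective_pairing). rewrite Ew.
  destruct (Rle_dec 0 b) as [Hb|Hb].
  - rewrite Rabs_pos_eq in Hxy by exact Hb. exists (x, y). unfold Cmult; simpl.
    apply injective_projections; simpl; lra.
  - rewrite Rabs_left in Hxy by lra. exists (x, (- y)%R). unfold Cmult; simpl.
    apply injective_projections; simpl; lra.
Qed.

(** * Curves in the projective line *)

Lemma is_RCderive_real_shift (f : C -> C) (x0 l : C) (x : R) :
  is_Cderive f (x + x0) l -> is_RCderive (fun y : R => f (y + x0)) x l.
Proof.
  intros H.
  apply (is_derive_ext (K := R_AbsRing) (V := C_R_NormedModule) (fun y : R => f (x0 + y * 1))).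
  { intros t. f_equal. ring. }
  replace l with (l * 1) by ring. apply is_RCderive_path.
  replace (x0 + x * 1) with (x + x0) by ring. exact H.
Qed.

Lemma is_derive_pair {K : AbsRing} {U V : NormedModule K} (f : K -> U) (g : K -> V) (x : K) (l : U) (m : V) :
  is_derive f x l -> is_derive g x m ->
  is_derive (V := prod_NormedModule K U V) (fun t => (f t, g t)) x (l, m).
Proof.
  intros Hf Hg. unfold is_derive.
  eapply filterdiff_ext_lin.
  - apply (filterdiff_comp_2 (W := prod_NormedModule K U V) f g (fun a b => (a, b))
             (fun y => scal y l) (fun y => scal y m) (fun a b => (a, b))); [exact Hf | exact Hg|].
    apply (filterdiff_ext (V := prod_NormedModule K U V) (fun t => t)); [intros []; reflexivity|].
    apply (filterdiff_ext_lin (V := prod_NormedModule K U V) _ (fun t => t)); [apply filterdiff_id|].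
    intros []; reflexivity.
  - intros y. reflexivity.
Qed.

Definition projective_point (v : C * C) (Hv : v <> (RtoC 0, RtoC 0)) : CP1 :=
  {| line := fun u => exists k : C, u = (k * fst v, k * snd v);
     line_spec := ex_intro _ v (conj Hv (fun u => iff_refl _)) |}.

Lemma homog_coord_scal (v : C * C) (Hv : v <> (RtoC 0, RtoC 0)) (k : C) :
  k <> 0 -> homog_coord (projective_point v Hv) (k * fst v, k * snd v).
Proof.
  intros Hk. split; [|exists k; reflexivity]. intros E. apply Hv.
  pose proof (f_equal fst E) as E1. pose proof (f_equal snd E) as E2. clear E.
  destruct v as [a b]; cbn [fst snd] in *.
  destruct (Cmult_integral _ _ E1) as [|Ea]; [contradiction|].
  destruct (Cmult_integral _ _ E2) as [|Eb]; [contradiction|]. rewrite Ea, Eb. reflexivity.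
Qed.

(** Conjugation by the exponential turns differentiation into differentiation plus [a]: [tw n k] is
    the n-th power of that operator applied to [D k]. The recursion avoids binomial coefficients. *)
Lemma exp_twist_derivatives (D : nat -> C -> C) (a : C) :
  (forall n z, is_Cderive (D n) z (D (S n) z)) ->
  exists A : nat -> C -> C, (forall z, A 0%nat z = D 0%nat z * Cexp (a * z)) /\
    forall n z, is_Cderive (A n) z (A (S n) z).
Proof.
  intros HD.
  set (tw := fix tw (n k : nat) (z : C) : C :=
    match n with 0%nat => D k z | S m => tw m (S k) z + a * tw m k z end).
  assert (Htw : forall n k z, is_Cderive (tw n k) z (tw n (S k) z)).
  { induction n as [|n IH]; intros k z; [apply HD|].
    change (is_Cderive (fun z => tw n (S k) z + a * tw n k z) z (tw n (S (S k)) z + a * tw n (S k) z)).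
    eapply is_Cderive_eq;
      [apply is_Cderive_plus; [apply IH | apply is_Cderive_mult; [apply is_Cderive_const | apply IH]]|]. cbv beta. ring. }
  exists (fun n z => tw n 0%nat z * Cexp (a * z)). split; [reflexivity|]. intros n z.
  eapply is_Cderive_eq; [apply is_Cderive_mult; [apply Htw | apply is_Cderive_Cexp_scal]|].
  change (tw (S n) 0%nat z) with (tw n 1%nat z + a * tw n 0%nat z). cbv beta. ring.
Qed.

(** * The Lamé equation *)

(** The sequence [D] is available at every point, whereas [zeta] and [wp] describe it only off [L].
    The simple zero at 0, read off from the limit of [sigma z / z], later decides the Wronskian. *)
Lemma sigma_derivatives (g2 g3 : C) (L : C -> Prop) (wp zeta sigma : C -> C) :
  weierstrass g2 g3 L wp zeta sigma ->
  exists D : nat -> C -> C,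
    (forall z, D 0%nat z = sigma z) /\ (forall n z, is_Cderive (D n) z (D (S n) z)) /\
    sigma 0 = 0 /\ D 1%nat 0 = 1 /\
    forall z, ~ L z -> D 1%nat z = zeta z * sigma z /\
      D 2%nat z = (zeta z * zeta z - wp z) * sigma z.
Proof.
  intros HW. pose proof (w_lattice _ _ _ _ _ _ HW) as HL.
  assert (HD : exists D : nat -> C -> C, (forall z, D 0%nat z = sigma z) /\
    forall n z, is_Cderive (D n) z (D (S n) z)).
  { destruct (sigma_entire _ _ _ _ _ _ HW) as [D [HD0 HD]]. exists D.
    split; [intros z; apply HD0; exact I | intros n z; apply HD; exact I]. }
  destruct HD as (D & E0 & HD').
  assert (Ds : forall z, is_Cderive sigma z (D 1%nat z)).
  { intros z. apply (is_Cderive_ext_near (D 0%nat) sigma z _ 1 ltac:(lra)); [intros w _; apply E0 | apply HD']. }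
  pose proof (filterlim_tends _ _ _ (sigma_zero _ _ _ _ _ _ HW)) as T.
  assert (S0 : sigma 0 = 0).
  { apply (tends_unique (pnbhd 0) sigma); [exact (tends_derivable _ _ _ (Ds 0))|].
    apply tends_ext with (f := fun z => z * (sigma z / z)); [typeclasses eauto| |].
    - generalize (pnbhd_neq 0). apply filter_imp. intros z Hz. field. exact Hz.
    - apply (tends_eq _ _ (0 * 1)); [|ring].
      apply tends_mult; [typeclasses eauto|apply tends_id|exact T]. }
  assert (S1 : D 1%nat 0 = 1).
  { apply (is_Cderive_unique sigma 0); [apply Ds|]. apply is_Cderive_slope.
    apply tends_ext with (f := fun z => sigma z / z); [typeclasses eauto| |exact T].
    apply filter_forall. intros z. rewrite S0. f_equal; [ring|]. f_equal. ring. }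
  assert (Z1 : forall z, ~ L z -> D 1%nat z = zeta z * sigma z).
  { intros z Hz. destruct (sigma_log_derive _ _ _ _ _ _ HW z Hz) as [Hn [s [Hs E]]].
    rewrite (is_Cderive_unique sigma z _ _ (Ds z) Hs), <- E. field. exact Hn. }
  exists D. split; [exact E0|]. split; [exact HD'|]. split; [exact S0|]. split; [exact S1|].
  intros z Hz. split; [apply Z1, Hz|].
  assert (Dz : is_Cderive zeta z (- wp z)) by exact (zeta_derive _ _ _ _ _ _ HW z Hz).
  assert (E : D 2%nat z - (- wp z * sigma z + zeta z * D 1%nat z) = 0).
  { apply (is_Cderive_zero_near (fun z => D 1%nat z - zeta z * sigma z) z).
    - destruct (lattice_closed L z HL Hz) as [r [Hr H]]. exists r; split; [exact Hr|].
      intros w Hw. rewrite Z1 by auto. ring.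
    - apply is_Cderive_minus; [apply HD'|]. apply is_Cderive_mult; [exact Dz | apply Ds]. }
  rewrite Z1 in E by exact Hz.
  replace (D 2%nat z) with (D 2%nat z - (- wp z * sigma z + zeta z * (zeta z * sigma z))
    + (- wp z * sigma z + zeta z * (zeta z * sigma z))) by ring.
  rewrite E. ring.
Qed.

Definition lame (zeta sigma : C -> C) (rho u : C) : C :=
  sigma (u - rho) / sigma u * Cexp (zeta rho * u).

(** The derivative of [lame], written with [sigma1 (u - rho)] instead of
    [zeta (u - rho) * sigma (u - rho)] so that it is also correct at the points of [rho + L]. *)
Definition lame1 (zeta sigma sigma1 : C -> C) (rho u : C) : C :=
  (sigma1 (u - rho) + sigma (u - rho) * (zeta rho - zeta u)) / sigma u * Cexp (zeta rho * u).

Lemma lame_equation (g2 g3 : C) (L : C -> Prop) (wp wp1 zeta sigma sigma1 sigma2 : C -> C) (rho : C) :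
  weierstrass g2 g3 L wp zeta sigma ->
  (forall z, ~ L z -> weierstrass_ode_at g2 g3 wp wp1 z) ->
  (forall z, is_Cderive sigma z (sigma1 z)) -> (forall z, is_Cderive sigma1 z (sigma2 z)) ->
  (exists sigma3, forall z, is_Cderive sigma2 z (sigma3 z)) ->
  (forall z, ~ L z -> sigma1 z = zeta z * sigma z /\ sigma2 z = (zeta z * zeta z - wp z) * sigma z) ->
  ~ L rho -> wp1 rho <> 0 ->
  forall u, ~ L u ->
    is_Cderive (lame zeta sigma rho) u (lame1 zeta sigma sigma1 rho u) /\
    is_Cderive (lame1 zeta sigma sigma1 rho) u ((2 * wp u + wp rho) * lame zeta sigma rho u).
Proof.
  intros HW Hode Ds Ds1 [sigma3 Ds2] Hs Hrho Hp.
  pose proof (w_lattice _ _ _ _ _ _ HW) as HL.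
  assert (Dz : forall z, ~ L z -> is_Cderive zeta z (- wp z)) by exact (zeta_derive _ _ _ _ _ _ HW).
  assert (Hsn : forall z, ~ L z -> sigma z <> 0) by (intros z Hz; apply (sigma_log_derive _ _ _ _ _ _ HW z Hz)).
  set (a := zeta rho).
  (* Up to the factor [Cexp (a * u) / sigma u], this is the defect of the Lamé equation. Off
     [rho + L] it is [sigma (u - rho)] times the defect of the addition theorem. *)
  set (T := fun u => sigma2 (u - rho) + 2 * (sigma1 (u - rho) * (a - zeta u))
    + sigma (u - rho) * ((a - zeta u) * (a - zeta u) - wp u - wp rho)).
  assert (Dshift : forall f f1 : C -> C, (forall z, is_Cderive f z (f1 z)) ->
     forall u, is_Cderive (fun u => f (u - rho)) u (f1 (u - rho))).
  { intros f f1 Hf u. apply (is_Cderive_shift f (- rho)). apply Hf. }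
  assert (T0 : forall u, ~ L u -> ~ L (u - rho) -> T u = 0).
  { intros u Hu Hu'. destruct (Hs _ Hu') as [E1 E2]. unfold T. rewrite E1, E2.
    pose proof (zeta_addition g2 g3 L wp wp1 zeta rho HL Hode (wp_periodic _ _ _ _ _ _ HW)
      (filterlim_tends _ _ _ (wp_pole _ _ _ _ _ _ HW)) Dz
      (filterlim_tends _ _ _ (zeta_pole _ _ _ _ _ _ HW)) Hrho Hp u Hu Hu') as K.
    fold a in K.
    replace ((zeta (u - rho) * zeta (u - rho) - wp (u - rho)) * sigma (u - rho) +
      2 * (zeta (u - rho) * sigma (u - rho) * (a - zeta u)) +
      sigma (u - rho) * ((a - zeta u) * (a - zeta u) - wp u - wp rho))
      with (sigma (u - rho) * ((zeta (u - rho) - zeta u + a) * (zeta (u - rho) - zeta u + a)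
        - (wp u + wp (u - rho) + wp rho))) by ring.
    rewrite K. ring. }
  (* The addition theorem is silent at points of [rho + L], but [T] is continuous there and vanishes
     at all nearby points; [sigma3] serves for the continuity of [sigma2]. *)
  assert (T1 : forall u, ~ L u -> T u = 0).
  { intros u Hu. apply (tends_unique (pnbhd u) T).
    - pose proof (tends_derivable _ _ _ (Dz u Hu)) as Tz.
      pose proof (tends_derivable _ _ _ (proj1 (Hode u Hu))) as Tw.
      pose proof (tends_derivable _ _ _ (Dshift _ _ Ds u)) as TS. cbv beta in TS.
      pose proof (tends_derivable _ _ _ (Dshift _ _ Ds1 u)) as TS1. cbv beta in TS1.
      pose proof (tends_derivable _ _ _ (Dshift _ _ Ds2 u)) as TS2. cbv beta in TS2.
      unfold T.
      repeat first [exact Tz | exact Tw | exact TS | exact TS1 | exact TS2 | apply tends_const; typeclasses eauto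
        | apply tends_minus; [typeclasses eauto| |] | apply tends_plus; [typeclasses eauto| |]
        | apply tends_mult; [typeclasses eauto| |]].
    - apply tends_ext with (f := fun _ => 0); [typeclasses eauto| |apply tends_const; typeclasses eauto].
      assert (H : pnbhd u (fun v => ~ L (v - rho))).
      { exact (pnbhd_shift u (- rho) _ (lattice_isolated L (u - rho) HL)). }
      generalize (filter_and (F := pnbhd u) _ _ H (lattice_isolated L u HL)). apply filter_imp.
      intros v [H1 H2]. symmetry. apply T0; assumption. }
  intros u Hu.
  pose proof (Hsn u Hu) as Nu. destruct (Hs u Hu) as [E1 _].
  pose proof (Ds u) as Du. pose proof (Dz u Hu) as Zu.
  pose proof (Dshift _ _ Ds u) as A0. pose proof (Dshift _ _ Ds1 u) as A1.
  pose proof (is_Cderive_Cexp_scal a u) as Du_exp.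
  assert (Di : is_Cderive (fun w => / sigma w) u (- zeta u * / sigma u)).
  { eapply is_Cderive_eq; [apply is_Cderive_inv; eassumption|]. rewrite E1. field. exact Nu. }
  split.
  - eapply is_Cderive_eq; [unfold lame; fold a; unfold Cdiv; apply is_Cderive_mult; [apply is_Cderive_mult|];
      eassumption|].
    unfold lame1. fold a. cbv beta. field. exact Nu.
  - eapply is_Cderive_eq.
    + unfold lame1; fold a; unfold Cdiv; apply is_Cderive_mult; [apply is_Cderive_mult|];
        [apply is_Cderive_plus|..]; [..|eassumption|eassumption]; [eassumption|].
      apply is_Cderive_mult; [eassumption|]. apply is_Cderive_minus; [apply is_Cderive_const | eassumption].
    + transitivity ((T u / sigma u + (2 * wp u + wp rho) * (sigma (u - rho) / sigma u)) * Cexp (a * u)).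
      * unfold T. cbv beta. field. exact Nu.
      * rewrite (T1 u Hu). unfold lame. fold a. field. exact Nu.
Qed.

(** * The normalised lift and its Schwarzian derivative *)

Theorem theorem2 (c d e g2 g3 : R)
  (Hg2 : g2 = (c ^ 2 / 12 - d)%R)
  (Hg3 : g3 = (- (c * d / 12) + e / 4 + c ^ 3 / 216)%R)
  (Hdisc : (g2 ^ 3 - 27 * g3 ^ 2 <> 0)%R)
  (L : C -> Prop) (wp zeta sigma : C -> C)
  (HW : weierstrass g2 g3 L wp zeta sigma)
  (x0 : C) (Hx0 : x0 <> 0) :
  let D := fun x : R => ~ L (x + x0) in
  let qt := q_tilde wp x0 c in
  (forall x : R, D x ->
     exists p : C, is_derive qt x p /\
       p * p + 2 * (qt x * qt x * qt x) + c * (qt x * qt x)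
         + 2 * d * qt x + e = 0) /\
  (forall (E : R) (rho : C), ~ L rho -> wp rho = E ->
     (4 * E ^ 3 - g2 * E - g3 <> 0)%R ->
     exists gamma : R -> CP1,
       smooth_curve gamma /\
       (forall x : R, D x ->
          homog_coord (gamma x) (gamma_hat zeta sigma x0 rho x)) /\
       schwarzian_on D gamma (fun x : R => qt x + / 6 * c - E)).
Proof.
  intros D qt.
  assert (HdiscC : g2 * g2 * g2 - 27 * (g3 * g3) <> 0).
  { rewrite <- !RtoC_mult, <- RtoC_minus. intros E. apply RtoC_inj in E. apply Hdisc. rewrite <- E. ring. }
  destruct (weierstrass_second_order _ _ _ _ _ _ HdiscC HW) as [wp1 Hode].
  pose proof (w_lattice _ _ _ _ _ _ HW) as HL.
  split.
  - intros x Hx. destruct (Hode _ Hx) as [D1 [_ E]].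
    exists (- (2) * wp1 (x + x0)). split.
    + apply (is_RCderive_real_shift (fun z => - (2) * wp z - / 6 * c)).
      eapply is_Cderive_eq; [apply is_Cderive_minus; [apply is_Cderive_mult;
        [apply is_Cderive_const | exact D1] | apply is_Cderive_const]|]. cbv beta. ring.
    (* The shift by [c / 6] makes the quadratic terms in [wp] cancel, and [g2], [g3] are the
       coefficients for which the remaining ones do. *)
    + unfold qt, q_tilde.
      assert (Eg2 : RtoC g2 = c * c / 12 - d).
      { rewrite Hg2, RtoC_minus, RtoC_div by lra. simpl. rewrite !RtoC_mult. field. }
      assert (Eg3 : RtoC g3 = - (c * d / 12) + e / 4 + c * c * c / 216).
      { rewrite Hg3, !RtoC_plus, RtoC_opp, !RtoC_div by lra. simpl. rewrite !RtoC_mult. field. }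
      replace (- (2) * wp1 (x + x0) * (- (2) * wp1 (x + x0))) with (4 * (wp1 (x + x0) * wp1 (x + x0))) by ring.
      rewrite E, Eg2, Eg3. field.
  - intros E rho Hrho HE Hbranch.
    assert (Hp : wp1 rho <> 0).
    { intros Ep. destruct (Hode rho Hrho) as [_ [_ Eo]]. rewrite Ep, HE in Eo.
      apply Hbranch. apply RtoC_inj. rewrite !RtoC_minus, !RtoC_mult. simpl. rewrite !RtoC_mult.
      replace (RtoC 0) with (RtoC 0 * 0) by ring. rewrite Eo. ring. }
    pose proof (weierstrass_even _ _ L wp wp1 HL Hode (filterlim_tends _ _ _ (wp_pole _ _ _ _ _ _ HW))) as Heven.
    destruct (Heven rho Hrho) as [Ev Ev1].
    assert (Hrho' : ~ L (- rho)) by (rewrite lattice_opp_iff by exact HL; exact Hrho).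
    assert (Hp' : wp1 (- rho) <> 0).
    { rewrite Ev1. intros E'. apply Hp. replace (wp1 rho) with (- - wp1 rho) by ring. rewrite E'. ring. }
    (* If [2 rho] were a period then [wp1 (- rho) = wp1 rho], and oddness of [wp1] would give
       [wp1 rho = 0]. *)
    assert (H2rho : ~ L (rho + rho)).
    { intros H2. assert (E1 : wp1 (- rho) = wp1 rho).
      { apply (is_Cderive_unique wp (- rho)); [apply (Hode _ Hrho')|].
        destruct (lattice_closed L (- rho) HL Hrho') as [r [Hr H]].
        apply (is_Cderive_ext_near (fun z => wp (z + (rho + rho))) wp (- rho) _ r Hr).
        - intros w Hw. apply (wp_periodic _ _ _ _ _ _ HW); auto.
        - apply is_Cderive_shift. replace (- rho + (rho + rho)) with rho by ring. apply (Hode _ Hrho). }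
      rewrite Ev1 in E1. apply Hp.
      replace (wp1 rho) with (/ 2 * (wp1 rho - - wp1 rho)) by field. rewrite E1. ring. }
    destruct (sigma_derivatives _ _ _ _ _ _ HW) as (S & HS0 & HS & Sz & S1z & Hs).
    assert (Ds : forall z, is_Cderive sigma z (S 1%nat z)).
    { intros z. apply (is_Cderive_ext_near (S 0%nat) sigma z _ 1 ltac:(lra)); [intros w _; apply HS0 | apply HS]. }
    assert (Hsn : forall z, ~ L z -> sigma z <> 0) by (intros z Hz; apply (sigma_log_derive _ _ _ _ _ _ HW z Hz)).
    assert (Hsz : forall z, sigma z = 0 -> L z).
    { intros z Hz. apply NNPP. intros Hn. exact (Hsn z Hn Hz). }
    set (f1 := lame zeta sigma rho). set (df1 := lame1 zeta sigma (S 1%nat) rho).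
    set (f2 := lame zeta sigma (- rho)). set (df2 := lame1 zeta sigma (S 1%nat) (- rho)).
    assert (F1 : forall u, ~ L u -> is_Cderive f1 u (df1 u) /\ is_Cderive df1 u ((2 * wp u + E) * f1 u)).
    { intros u Hu. rewrite <- HE. apply (lame_equation g2 g3 L wp wp1 zeta sigma (S 1%nat) (S 2%nat)); auto.
      exists (S 3%nat). apply HS. }
    assert (F2 : forall u, ~ L u -> is_Cderive f2 u (df2 u) /\ is_Cderive df2 u ((2 * wp u + E) * f2 u)).
    { intros u Hu. rewrite <- HE, <- Ev. apply (lame_equation g2 g3 L wp wp1 zeta sigma (S 1%nat) (S 2%nat)); auto.
      exists (S 3%nat). apply HS. }
    set (W := f1 rho * df2 rho - df1 rho * f2 rho).
    assert (HWc : forall u, ~ L u -> f1 u * df2 u - df1 u * f2 u = W).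
    { intros u Hu. apply (lattice_compl_const L (fun u => f1 u * df2 u - df1 u * f2 u) HL); [|assumption..].
      intros v Hv. destruct (F1 v Hv) as [A1 A2]. destruct (F2 v Hv) as [B1 B2].
      eapply is_Cderive_eq; [apply is_Cderive_minus; apply is_Cderive_mult; eassumption|]. cbv beta. ring. }
    (* Since [sigma 0 = 0] and [sigma' 0 = 1], [f1] has a simple zero at [rho]. Thus
       [W = - df1 rho * f2 rho], and [f2 rho] is a nonzero multiple of [sigma (2 rho)]. *)
    assert (HWn : W <> 0).
    { assert (E1 : f1 rho = 0).
      { unfold f1, lame. replace (rho - rho) with (RtoC 0) by ring. rewrite Sz. unfold Cdiv. ring. }
      assert (N1 : df1 rho <> 0).
      { unfold df1, lame1. replace (rho - rho) with (RtoC 0) by ring. rewrite Sz, S1z.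
        repeat apply Cmult_neq_0; [|apply Cinv_neq_0, Hsn, Hrho | apply Cexp_neq_0].
        rewrite Cmult_0_l, Cplus_0_r. apply C1_nz. }
      assert (N2 : f2 rho <> 0).
      { unfold f2, lame. replace (rho - - rho) with (rho + rho) by ring.
        repeat apply Cmult_neq_0; [apply Hsn, H2rho|apply Cinv_neq_0, Hsn, Hrho | apply Cexp_neq_0]. }
      unfold W. rewrite E1. intros E'. apply (Cmult_neq_0 _ _ N1 N2).
      replace (df1 rho * f2 rho) with (- (0 * df2 rho - df1 rho * f2 rho)) by ring. rewrite E'. ring. }
    set (h0 := fun x : R => (sigma (x + x0 - rho) * Cexp (zeta rho * (x + x0)),
                             sigma (x + x0 + rho) * Cexp (zeta (- rho) * (x + x0)))).
    (* At a common zero both [x + x0 - rho] and [x + x0 + rho] would lie in [L], and so would their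
       difference [2 rho]. *)
    assert (h0n : forall x, h0 x <> (RtoC 0, RtoC 0)).
    { intros x Ex. pose proof (f_equal fst Ex) as E1. pose proof (f_equal snd Ex) as E2.
      unfold h0 in E1, E2; cbn [fst snd] in E1, E2.
      destruct (Cmult_integral _ _ E1) as [E1'|E1']; [|exact (Cexp_neq_0 _ E1')].
      destruct (Cmult_integral _ _ E2) as [E2'|E2']; [|exact (Cexp_neq_0 _ E2')].
      apply H2rho. replace (rho + rho) with ((x + x0 + rho) + - (x + x0 - rho)) by ring.
      apply lattice_plus; [exact HL | apply Hsz, E2' | apply lattice_opp; [exact HL | apply Hsz, E1']]. }
    set (gamma := fun x => projective_point (h0 x) (h0n x)).
    assert (Ehat : forall x, gamma_hat zeta sigma x0 rho x
       = (/ sigma (x + x0) * fst (h0 x), / sigma (x + x0) * snd (h0 x))).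
    { intros x. unfold gamma_hat, h0; cbn [fst snd]. f_equal; unfold Cdiv; ring. }
    assert (Ef : forall x : R, gamma_hat zeta sigma x0 rho x = (f1 (x + x0), f2 (x + x0))).
    { intros x. unfold gamma_hat, f1, f2, lame. do 4 f_equal. ring. }
    assert (Hhat : forall (x : R) (k : C), D x -> k <> 0 ->
       homog_coord (gamma x) (k * f1 (x + x0), k * f2 (x + x0))).
    { intros x k Hx Hk. pose proof (Ehat x) as E1. rewrite Ef in E1.
      pose proof (f_equal fst E1) as A1. pose proof (f_equal snd E1) as A2. cbn [fst snd] in A1, A2.
      rewrite A1, A2, !Cmult_assoc. apply homog_coord_scal.
      apply Cmult_neq_0; [exact Hk | apply Cinv_neq_0, Hsn, Hx]. }
    exists gamma. split; [|split].
    + intros y.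
      destruct (exp_twist_derivatives (fun n z => S n (z - rho)) (zeta rho)) as [A [A0 HA]].
      { intros n z. apply (is_Cderive_shift (S n) (- rho)). apply HS. }
      destruct (exp_twist_derivatives (fun n z => S n (z + rho)) (zeta (- rho))) as [B [B0 HB]].
      { intros n z. apply (is_Cderive_shift (S n) rho). apply HS. }
      exists (mkposreal 1 Rlt_0_1), h0. split.
      * exists (fun (n : nat) (x : R) => (A n (x + x0), B n (x + x0))). split.
        -- intros x _. rewrite A0, B0, !HS0. reflexivity.
        -- intros n x _. apply (is_derive_pair (K := R_AbsRing)); apply is_RCderive_real_shift; [apply HA | apply HB].
      * intros x _. split; [apply h0n|]. exists 1. rewrite !Cmult_1_l. apply surjective_pairing.
    + intros x Hx. rewrite Ef. replace (f1 (x + x0)) with (1 * f1 (x + x0)) by ring.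
      replace (f2 (x + x0)) with (1 * f2 (x + x0)) by ring. apply Hhat; [exact Hx | apply C1_nz].
    (* Scaling a lift by a constant [k] multiplies its determinant [W] by [k^2]. The equation is
       unaffected, and [qt x + / 6 * c - E] is [- (2 * wp (x + x0) + E)]. *)
    + destruct (complex_square_root (/ W)) as [k Hk].
      assert (Hk0 : k <> 0).
      { intros ->. rewrite Cmult_0_l in Hk. exact (Cinv_neq_0 _ HWn (eq_sym Hk)). }
      exists (fun x : R => (k * f1 (x + x0), k * f2 (x + x0))),
             (fun x : R => (k * df1 (x + x0), k * df2 (x + x0))),
             (fun x : R => (k * ((2 * wp (x + x0) + E) * f1 (x + x0)), k * ((2 * wp (x + x0) + E) * f2 (x + x0)))).
      assert (Dk : forall (f : C -> C) (u l : C), is_Cderive f u l -> is_Cderive (fun u => k * f u) u (k * l)).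
      { intros f u l Hf. eapply is_Cderive_eq; [apply is_Cderive_mult; [apply is_Cderive_const | exact Hf]|].
        cbv beta. ring. }
      intros x Hx. destruct (F1 _ Hx) as [A1 A2]. destruct (F2 _ Hx) as [B1 B2].
      split; [apply Hhat; assumption|]. split; [|split; [|split; [|split]]].
      * apply (is_derive_pair (K := R_AbsRing)).
        -- apply (is_RCderive_real_shift (fun u => k * f1 u)). apply Dk, A1.
        -- apply (is_RCderive_real_shift (fun u => k * f2 u)). apply Dk, B1.
      * apply (is_derive_pair (K := R_AbsRing)).
        -- apply (is_RCderive_real_shift (fun u => k * df1 u)). apply Dk, A2.
        -- apply (is_RCderive_real_shift (fun u => k * df2 u)). apply Dk, B2.
      * unfold det2; cbn [fst snd].
        replace (k * f1 (x + x0) * (k * df2 (x + x0)) - k * f2 (x + x0) * (k * df1 (x + x0)))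
          with (k * k * (f1 (x + x0) * df2 (x + x0) - df1 (x + x0) * f2 (x + x0))) by ring.
        rewrite (HWc _ Hx), Hk. field. exact HWn.
      * unfold qt, q_tilde; cbn [fst snd]. ring.
      * unfold qt, q_tilde; cbn [fst snd]. ring.
Qed.
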